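(* Let $H:\mathbb R^n\rightrightarrows\mathbb R^n$ be a closed-graph mapping and $h:\mathbb R^d\times\mathbb R^n\to\mathbb R^n$ a $\mathcal C^1$ function, and let $$S(p,v)=\{x\;:\;h(p,x)+H(x)\ni v\}.$$ Let $\bar x\in S(\bar p,\bar v)$, so that $\bar v-h(\bar p,\bar x)\in H(\bar x)$, and suppose that $H$ is crypto-continuous at $\bar x$ for $\bar v-h(\bar p,\bar x)$. Then $S$ has a single-valued Lipschitz continuous localization at $(\bar p,\bar v)$ for $\bar x$ if and only if $$\nabla_xh(\bar p,\bar x)x'+D_*H\big(\bar x\,|\,\bar v-h(\bar p,\bar x)\big)(x')\ni0\ \Longrightarrow\ x'=0.$$
   Context: **Strict graphical derivative.** For $S:\mathbb R^N\rightrightarrows\mathbb R^M$ and $\bar w\in S(\bar z)$: $w'\in D_*S(\bar z|\bar w)(z')$ iff there are $t_k\searrow0$, $(z_k,w_k)\to(\bar z,\bar w)$ in $\operatorname{gph}S$ and $(z_k',w_k')\to(z',w')$ with $w_k+t_kw_k'\in S(z_k+t_kz_k')$. **Single-valued localization.** A single-valued localization of $S$ at $\bar z$ for $\bar w\in S(\bar z)$ is a single-valued mapping $s:\mathcal Z\to\mathcal W$ with $s(\bar z)=\bar w$ and $\operatorname{gph}s=[\mathcal Z\times\mathcal W]\cap\operatorname{gph}S$ for some neighborhood $\mathcal Z\times\mathcal W$ of $(\bar z,\bar w)$. **Crypto-continuity.** $S:\mathbb R^N\rightrightarrows\mathbb R^M$ is crypto-continuous at $\bar z$ for $\bar w\in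 S(\bar z)$ if there is a neighborhood $\mathcal Z\times\mathcal W$ of $(\bar z,\bar w)$ such that $C=[\mathcal Z\times\mathcal W]\cap\operatorname{gph}S$ has a continuous parameterization $C=\{(f(\omega),g(\omega)):\omega\in\Omega\}$ over an open set $\Omega\subset\mathbb R^N$ ($N$ the dimension of the domain space) whose inverse from $C$ to $\Omega$ is single-valued and continuous. *)

(* Defs.v *)
From HB Require Import structures.
From mathcomp Require Import all_boot all_order all_algebra.
From mathcomp Require Import all_classical all_reals all_analysis.

Set Implicit Arguments.
Unset Strict Implicit.
Unset Printing Implicit Defensive.

Import Order.TTheory GRing.Theory Num.Theory.
Import numFieldNormedType.Exports.

Local Open Scope classical_set_scope.
Local Open Scope ring_scope.

(* A set-valued mapping U ==> V is a function U -> set V, possibly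
   empty-valued. *)
Definition gph (U V : Type) (S : U -> set V) : set (U * V) :=
  [set zw | S zw.1 zw.2].

Section StrictGraphicalDerivative.
Variables (R : realType) (U V : normedModType R).

(* [strict_graphical_derivative S z w z'] is the set D_*S(z|w)(z'); "t_k
   decreases to 0" means t_k > 0 and t_k --> 0, without monotonicity. *)
Definition strict_graphical_derivative (S : U -> set V) (z : U) (w : V)
    (z' : U) : set V :=
  [set w' | exists (t : nat -> R) (zk : nat -> U) (wk : nat -> V)
                   (zk' : nat -> U) (wk' : nat -> V),
    [/\ (forall k, 0 < t k) /\ t @ \oo --> (0 : R),
        forall k, gph S (zk k, wk k),
        zk @ \oo --> z /\ wk @ \oo --> w,
        zk' @ \oo --> z' /\ wk' @ \oo --> w' &
        forall k, S (zk k + t k *: zk' k) (wk k + t k *: wk' k)]].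

(* Outside Z the values of the total function s are irrelevant; that s maps Z
   into W is part of the graph equation. *)
Definition single_valued_localization (S : U -> set V) (z : U) (w : V)
    (Z : set U) (W : set V) (s : U -> V) : Prop :=
  [/\ nbhs z Z, nbhs w W, s z = w &
      [set (u, s u) | u in Z] = (Z `*` W) `&` gph S].

Definition has_lipschitz_localization (S : U -> set V) (z : U) (w : V) : Prop :=
  exists (Z : set U) (W : set V) (s : U -> V),
    single_valued_localization S z w Z W s /\ [lipschitz s u | u in Z].

(* The last clause is continuity of the derivative in operator norm. *)
Definition is_C1 (f : U -> V) : Prop :=
  (forall x, differentiable f x) /\
  (forall x (e : R), 0 < e ->
     \forall y \near x, forall u, `|'d f y u - 'd f x u| <= e * `|u|).

End StrictGraphicalDerivative.

(* [om] is the inverse of the parameterization on C; its existence as a function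
   makes that inverse single-valued. *)
Definition crypto_continuous (R : realType) (N M : nat)
    (S : 'rV[R]_N -> set 'rV[R]_M) (z : 'rV[R]_N) (w : 'rV[R]_M) : Prop :=
  exists (Z : set 'rV[R]_N) (W : set 'rV[R]_M),
    [/\ nbhs z Z, nbhs w W &
    let C := (Z `*` W) `&` gph S in
    exists (Omega : set 'rV[R]_N) (f : 'rV[R]_N -> 'rV[R]_N)
           (g : 'rV[R]_N -> 'rV[R]_M) (om : 'rV[R]_N * 'rV[R]_M -> 'rV[R]_N),
    [/\ open Omega,
        {within Omega, continuous f} /\ {within Omega, continuous g},
        C = [set (f o, g o) | o in Omega],
        (forall o, Omega o -> om (f o, g o) = o) &
        {within C, continuous om}]].

Definition solution_mapping (R : realType) (d n : nat)
    (h : 'rV[R]_d * 'rV[R]_n -> 'rV[R]_n) (H : 'rV[R]_n -> set 'rV[R]_n)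
    (pv : 'rV[R]_d * 'rV[R]_n) : set 'rV[R]_n :=
  [set x | exists2 y, H x y & h (pv.1, x) + y = pv.2].

(* Main.v *)
(* If the kernel condition holds, a compactness argument along secants shows that
   on the graph of [H] near the reference point |x - x'| is bounded by a multiple
   of |p - p'| + |v - v'|, where v = h(p,x) + y and v' = h(p',x') + y'.  Solutions
   are therefore unique and Lipschitz in (p, v), and their existence is a matter
   of openness: composed with the crypto-continuous parameterization,
   (x, y) |-> h(pb,x) + y becomes a continuous injective map between subsets of
   R^n, so invariance of domain applies, in a form stable under the small
   perturbation caused by p.  Conversely, a Lipschitz localization forces the
   estimate |x - x'| <= M |v - v'|, which passes to the limit in difference
   quotients and kills the kernel.

   Invariance of domain is derived from the Poincare-Miranda theorem, itself a
   consequence of a cubical Sperner lemma.  The latter is proved with cochains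
   modulo 2 on the Freudenthal triangulation: the sum over all simplices of the
   cup product of the coboundaries of the n labellings depends only on the
   boundary values, by Stokes, and is 1 for the labellings that mark the faces
   x_i = max. *)
Require Import Defs.
From HB Require Import structures.
From mathcomp Require Import all_boot all_order all_algebra all_fingroup.
From mathcomp Require Import ring lra.
From mathcomp Require Import all_classical all_reals all_analysis.

Set Implicit Arguments.
Unset Strict Implicit.
Unset Printing Implicit Defensive.

Import Order.TTheory GRing.Theory Num.Theory.
Import numFieldNormedType.Exports.

Local Open Scope classical_set_scope.
Local Open Scope ring_scope.

(** * A cubical Sperner lemma *)

Section Cochains.
Variable V : Type.
Implicit Types (l : V -> 'F_2) (B : seq V -> 'F_2) (s : seq V).

Lemma addrr_F2 (x : 'F_2) : x + x = 0.
Proof. exact: addrr_pchar2 (pchar_Fp _) _. Qed.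

Fixpoint coboundary B s : 'F_2 :=
  if s is v :: s' then B s' + coboundary (fun u => B (v :: u)) s' else 0.

(* The cup product of the coboundary of [l] with [B]. *)
Definition cup l B s : 'F_2 :=
  if s is v0 :: ((v1 :: _) as s') then (l v1 + l v0) * B s' else 0.

(** The cup product of [l] itself, as a 0-cochain, with [B]. *)
Definition head_mul l B s : 'F_2 := if s is v :: _ then l v * B s else 0.

Definition cups (ls : seq (V -> 'F_2)) := foldr cup (fun=> 1) ls.

Lemma coboundaryE B s :
  coboundary B s = \sum_(j < size s) B (take j s ++ drop j.+1 s).
Proof.
elim: s B => [|v s IHs] B /=; first by rewrite big_ord0.
by rewrite big_ord_recl /= drop0 IHs.
Qed.

Lemma coboundaryZ (a : 'F_2) B s :
  coboundary (fun u => a * B u) s = a * coboundary B s.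
Proof.
elim: s B => [|v s IHs] B /=; first by rewrite mulr0.
by rewrite mulrDr IHs.
Qed.

(** Leibniz rule for a closed factor: deleting [v0] and deleting [v1] give [l v2 + l v1] and
    [l v2 + l v0] times the same value of [B], and modulo 2 these add up to [l v1 + l v0]. *)
Lemma coboundary_cup l B v0 v1 v2 s :
  coboundary (cup l B) [:: v0, v1, v2 & s] =
  (l v1 + l v0) * coboundary B [:: v1, v2 & s].
Proof.
rewrite /= !coboundaryZ.
set b := B _; set b' := B _; set c := coboundary _ _.
set x := l v0; set y := l v1; set z := l v2.
(* Doubled terms, zero modulo 2, are added so that both sides agree as polynomials. *)
rewrite -[RHS]addr0 -(addrr_F2 (z * b)) -[RHS]addr0 -(addrr_F2 (y * b)).
by rewrite -[LHS]addr0 -(addrr_F2 (y * b)); ring.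
Qed.

Lemma coboundary_head_mul l B v0 v1 s :
  coboundary (head_mul l B) [:: v0, v1 & s] =
  cup l B [:: v0, v1 & s] + l v0 * coboundary B [:: v0, v1 & s].
Proof.
rewrite /= coboundaryZ mulrDr -[LHS]addr0 -(addrr_F2 (l v0 * B (v1 :: s))).
by rewrite mulrDl; ring.
Qed.

(** By the Leibniz rule this reduces to the constant cochain 1, whose coboundary on two vertices is
    1 + 1. *)
Lemma coboundary_cups ls s :
  size s = (size ls).+2 -> coboundary (cups ls) s = 0.
Proof.
elim: ls s => [|l ls IHls] [|v0 [|v1 s]] //= [].
  by case: s => //= _; rewrite addr0 addrr_F2.
case: s => [//|v2 s] [sz].
by rewrite [LHS]coboundary_cup IHls ?mulr0 //= sz.
Qed.

(* A primitive of [cups (ls1 ++ l :: ls2)], obtained by replacing the coboundary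
   of [l] by [l]. *)
Definition cups_primitive ls1 l ls2 :=
  foldr cup (head_mul l (cups ls2)) ls1.

Lemma coboundary_primitive ls1 l ls2 s :
  size s = (size ls1 + size ls2).+2 ->
  coboundary (cups_primitive ls1 l ls2) s = cups (ls1 ++ l :: ls2) s.
Proof.
elim: ls1 s => [|l1 ls1 IH] [|v0 [|v1 s]] //= [] sz.
  rewrite [LHS]coboundary_head_mul coboundary_cups ?mulr0 ?addr0 //=.
  by rewrite sz.
case: s sz => [|v2 s] [sz]; first by rewrite addSn in sz.
by rewrite [LHS]coboundary_cup IH //= sz.
Qed.

Lemma cupsD ls1 l l' ls2 s :
  cups (ls1 ++ l :: ls2) s + cups (ls1 ++ l' :: ls2) s =
  cups (ls1 ++ (fun v => l v + l' v) :: ls2) s.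
Proof.
elim: ls1 s => [|l1 ls1 IH] [|v0 [|v1 s]] //=; rewrite ?addr0 //.
  by rewrite -mulrDl; congr (_ * _); ring.
by rewrite -mulrDr IH.
Qed.

Lemma cupsE v0 ls s : size s = (size ls).+1 ->
  cups ls s = \prod_(i < size ls) (nth (fun=> 0) ls i (nth v0 s i.+1) +
                                   nth (fun=> 0) ls i (nth v0 s i)).
Proof.
elim: ls s => [|l ls IH] [|v [|v1 s]] //= sz; first by rewrite big_ord0.
case: sz => sz; by rewrite big_ord_recl /= -IH //= sz.
Qed.

Definition vanishes_on (P : pred V) B := forall s, all P s -> B s = 0.

Lemma vanishes_cup (P : pred V) l B : vanishes_on P B -> vanishes_on P (cup l B).
Proof.
by move=> PB [|v0 [|v1 s]] //= /andP[_ Ps]; rewrite PB ?mulr0.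
Qed.

Lemma vanishes_cup_const (P : pred V) l B a :
  (forall v, P v -> l v = a) -> vanishes_on P (cup l B).
Proof.
move=> Pl [|v0 [|v1 s]] //= /and3P[P0 P1 _].
by rewrite !Pl // addrr_F2 mul0r.
Qed.

Lemma vanishes_foldr (P : pred V) ls B :
  vanishes_on P B -> vanishes_on P (foldr cup B ls).
Proof. by move=> PB; elim: ls => //= l ls IH; exact: vanishes_cup. Qed.

Lemma vanishes_head_mul (P : pred V) l B :
  vanishes_on P B -> vanishes_on P (head_mul l B).
Proof. by move=> PB [|v s] //= Ps; rewrite PB ?mulr0. Qed.

Lemma vanishes_head_mul0 (P : pred V) l B :
  (forall v, P v -> l v = 0) -> vanishes_on P (head_mul l B).
Proof. by move=> Pl [|v s] //= /andP[Pv _]; rewrite Pl ?mul0r. Qed.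

End Cochains.

Lemma vanishes_foldr_const (V : Type) (I : eqType) (P : pred V)
    (lam : I -> V -> 'F_2) (r : seq I) (c : I) a B :
  c \in r -> (forall v, P v -> lam c v = a) ->
  vanishes_on P (foldr (@cup V) B (map lam r)).
Proof.
move=> + Pc; elim: r => //= i r IH; rewrite inE => /orP[/eqP <-|cr].
  exact: vanishes_cup_const Pc.
by apply: vanishes_cup; exact: IH.
Qed.

Lemma sum_involution_F2 (T : finType) (phi : T -> T) (b : pred T)
    (F : T -> 'F_2) :
  involutive phi -> (forall x, b (phi x) = ~~ b x) ->
  (forall x, F (phi x) = F x) -> \sum_x F x = 0.
Proof.
move=> phiK bphi Fphi; rewrite (bigID b) /= [X in _ + X](reindex_inj (inv_inj phiK)).
by rewrite [X in _ + X](eq_big b F) ?addrr_F2 // => x; rewrite bphi negbK.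
Qed.

(** * The Freudenthal triangulation and Stokes' theorem modulo 2 *)

Section Freudenthal.
Variables n p : nat.

(* The simplices of the Freudenthal triangulation of [0, p + 1]^n: the simplex
   [(q, sigma)] climbs from [q] to [q + (1, ..., 1)], increasing coordinate [c]
   at step [sigma c]. *)
Definition simplex : Type := ({ffun 'I_n -> 'I_p.+1} * 'S_n)%type.

Definition vertex (x : simplex) (j : nat) : {ffun 'I_n -> nat} :=
  [ffun c => x.1 c + (x.2 c < j)]%N.

Definition chain (x : simplex) := map (vertex x) (iota 0 n.+1).

Definition face (c : 'I_n) (a : nat) : pred {ffun 'I_n -> nat} :=
  fun v => v c == a.

Lemma take_drop_chain (x : simplex) j :
  take j (chain x) ++ drop j.+1 (chain x) =
  map (vertex x) (take j (iota 0 n.+1) ++ drop j.+1 (iota 0 n.+1)).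
Proof. by rewrite map_cat map_take map_drop. Qed.

Lemma first_face (x : simplex) :
  take 0 (chain x) ++ drop 1 (chain x) = map (vertex x) (iota 1 n).
Proof. by rewrite /= drop0. Qed.

Lemma last_face (x : simplex) :
  take n (chain x) ++ drop n.+1 (chain x) = map (vertex x) (iota 0 n).
Proof.
rewrite take_drop_chain take_iota drop_oversize ?size_iota // cats0.
by rewrite (minn_idPl (leqnSn _)).
Qed.

(** Exchanging the steps [j - 1] and [j] moves only vertex [j], so two simplices share the face
    opposite to it; the parity of the permutation tells them apart, and they cancel modulo 2. *)
Lemma interior_face_sum (w : seq {ffun 'I_n -> nat} -> 'F_2) (j : nat) :
  (0 < j < n)%N ->
  \sum_(x : simplex) w (take j (chain x) ++ drop j.+1 (chain x)) = 0.
Proof.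
move=> /andP[j0 jn].
have j1n : (j.-1 < n)%N by rewrite (leq_ltn_trans (leq_pred _)).
pose t : 'S_n := tperm (Ordinal j1n) (Ordinal jn).
have tne : Ordinal j1n != Ordinal jn by rewrite -val_eqE /= ltn_eqF // prednK.
pose phi (x : simplex) : simplex := (x.1, (x.2 * t)%g).
apply: (@sum_involution_F2 _ phi (fun x => odd_perm x.2)).
- by move=> [q s]; rewrite /phi /= -mulgA tperm2 mulg1.
- by move=> [q s]; rewrite /phi /= odd_permM odd_tperm tne addbT.
move=> x; rewrite !take_drop_chain; congr (w _); apply/eq_in_map => i.
rewrite mem_cat take_iota drop_iota !mem_iota => ij.
have {}ij : (i != j)%N.
  apply: contraTneq ij => ->; rewrite add0n leq0n /= addSn ltnn /=.
  by rewrite orbF -leqNgt geq_minl.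
apply/ffunP => c; rewrite !ffunE /= permM; congr (_ + nat_of_bool _)%N.
case: tpermP => [->|->|//] /=.
- by rewrite ltn_neqAle eq_sym ij /= -ltnS prednK // -[in RHS]ltnS prednK.
- by rewrite [in RHS]ltn_neqAle eq_sym ij /= -ltnS prednK // -[in LHS]ltnS prednK.
Qed.

(** The neighbour across the face opposite the first vertex: the start moves to the second vertex,
    and the coordinate climbed first is now climbed last. Wrapping around with [ordS] makes this an
    injection of all simplices into themselves. *)
Definition shift_simplex (x : simplex) : simplex :=
  ([ffun c => if x.2 c == 0%N :> nat then ordS (x.1 c) else x.1 c],
   (x.2 * perm (@ord_pred_inj n))%g).

Lemma shift_simplex_inj : injective shift_simplex.
Proof.
move=> [q s] [q' s'] [/ffunP eq_q /mulIg eq_s]; rewrite eq_s; congr (_, _).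
apply/ffunP => c; have := eq_q c; rewrite !ffunE /= eq_s.
by case: ifP => // _ /ordS_inj.
Qed.

Lemma shift_simplex_vertex (x : simplex) j :
  (forall c, x.2 c = 0%N :> nat -> x.1 c != ord_max) -> (j < n)%N ->
  vertex (shift_simplex x) j = vertex x j.+1.
Proof.
move=> x0 jn; apply/ffunP => c; rewrite !ffunE /= permM permE /=.
have n0 := leq_ltn_trans (leq0n j) jn.
have [c0|cn0] := eqVneq (x.2 c : nat) 0%N.
  rewrite c0 add0n modn_small ?ltn_predL // ltnNge -ltnS prednK // jn addn0 ltn0Sn.
  have := x0 _ c0; rewrite -val_eqE /= => qmax.
  by rewrite modn_small ?addn1 // ltnS ltn_neqAle qmax -ltnS ltn_ord.
have -> : ((x.2 c + n).-1 = (x.2 c).-1 + n)%N.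
  by rewrite -[in LHS](@prednK (x.2 c)) ?lt0n.
have ltn : ((x.2 c).-1 < n)%N by rewrite (leq_ltn_trans (leq_pred _)).
by rewrite modnDr modn_small //; case: (x.2 c : nat) cn0.
Qed.

(** Faces opposite an interior vertex cancel in pairs. The first face of a simplex is the last face
    of its shift, unless the shift wraps around; then both lie on the boundary, where [w]
    vanishes. *)
Lemma sum_coboundary (w : seq {ffun 'I_n -> nat} -> 'F_2) :
  (0 < n)%N ->
  (forall c, vanishes_on (face c 0) w) ->
  (forall c, vanishes_on (face c p.+1) w) ->
  \sum_(x : simplex) coboundary w (chain x) = 0.
Proof.
move=> n0 w0 wp.
have szc x : size (chain x) = n.+1 by rewrite size_map size_iota.
under eq_bigr => x _ do rewrite coboundaryE szc.
rewrite exchange_big /=.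
have ends m (F : nat -> 'F_2) : (0 < m)%N ->
    (forall j, (0 < j < m)%N -> F j = 0) -> \sum_(j < m.+1) F j = F 0%N + F m.
  case: m => // m _ F0; rewrite big_ord_recl big_ord_recr /= big1 ?add0r // => j _.
  by rewrite /bump F0 // add1n /= ltnS.
rewrite (ends n (fun j => \sum_x w (take j (chain x) ++ drop j.+1 (chain x)))) //;
  last exact: interior_face_sum.
rewrite [X in _ + X](reindex_inj shift_simplex_inj) -big_split big1 // => x _.
rewrite first_face last_face.
have [/forallP x0|] := boolP [forall c, (x.2 c == 0%N :> nat) ==> (x.1 c != ord_max)].
  rewrite (_ : map _ (iota 1 n) = map (vertex (shift_simplex x)) (iota 0 n)).
    exact: addrr_F2.
  rewrite (iotaDl 1 0 n : iota 1 n = _) -map_comp; apply/eq_in_map => j.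
  rewrite mem_iota => /andP[_ jn]; rewrite /= add1n -shift_simplex_vertex //.
  by move=> c /eqP; apply/implyP.
(* Coordinate [c] wraps around: the first face lies in the side [p.+1] of the cube, and the last
   face of the shifted simplex in the side [0]. *)
rewrite negb_forall => /existsP[c]; rewrite negb_imply negbK => /andP[/eqP xc0 /eqP xcm].
have -> : w (map (vertex x) (iota 1 n)) = 0.
  apply: (wp c); apply/allP => _ /mapP[j + ->]; rewrite mem_iota => /andP[j1 _].
  by rewrite /face !ffunE /= xc0 xcm j1 addn1.
have -> : w (map (vertex (shift_simplex x)) (iota 0 n)) = 0; last exact: addr0.
apply: (w0 c); apply/allP => _ /mapP[j + ->]; rewrite mem_iota => /andP[_ jn].
rewrite /face !ffunE /= permM permE /= xc0 eqxx xcm /= modnn.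
by rewrite add0n modn_small ?ltn_predL // ltnNge -ltnS prednK // jn.
Qed.

End Freudenthal.

(** * The degree of a labelling of the cube *)

Section Degree.
Variables n p : nat.
Local Notation V := {ffun 'I_n -> nat}.

Definition degree (lam : 'I_n -> V -> 'F_2) : 'F_2 :=
  \sum_(x : simplex n p) cups (map lam (enum 'I_n)) (chain x).

Definition separating (lam : 'I_n -> V -> 'F_2) :=
  (forall i (v : V), v i = 0%N -> lam i v = 0) /\
  (forall i (v : V), v i = p.+1 -> lam i v = 1).

(** The degrees differ by a sum of coboundaries of a primitive built on [mu]. It vanishes on the
    boundary: on the sides for [k] because [mu] does, on those for another [c] because [lam c] is
    constant there. *)
Lemma degree_change (lam lam' : 'I_n -> V -> 'F_2) (k : 'I_n) :
  separating lam -> separating lam' ->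
  (forall i, i != k -> lam i = lam' i) -> degree lam = degree lam'.
Proof.
move=> [lam0 lamP] [lam'0 lam'P] eq_lam.
have n0 : (0 < n)%N by exact: leq_ltn_trans (leq0n k) (ltn_ord k).
have [r1 [r2 r12]] : exists r1 r2, enum 'I_n = r1 ++ k :: r2.
  by have := mem_enum 'I_n k; case/splitPr => r1 r2; exists r1, r2.
have := enum_uniq 'I_n; rewrite r12 cat_uniq /= => /and3P[_ kr /andP[kr2 _]].
have kr1 : k \notin r1 by apply: contra kr => ->.
have eq_map r : k \notin r -> map lam' r = map lam r.
  move=> kNr; apply/eq_in_map => i ir; rewrite eq_lam //.
  by apply: contraNneq kNr => <-.
pose mu v := lam k v + lam' k v.
apply/eqP; rewrite -subr_eq0 (oppr_pchar2 (pchar_Fp _)) // -big_split /= r12 !map_cat /=.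
rewrite !eq_map //; under eq_bigr => x _ do rewrite cupsD.
apply/eqP.
rewrite -[RHS](@sum_coboundary n p (cups_primitive (map lam r1) mu (map lam r2))) //.
- apply: eq_bigr => x _; rewrite coboundary_primitive //.
  rewrite !size_map size_iota -addnS.
  by have := size_enum_ord n; rewrite r12 size_cat /= => ->.
- move=> c; have : c \in enum 'I_n by rewrite mem_enum.
  rewrite /cups_primitive /cups r12 mem_cat inE => /or3P[cr|/eqP ->|cr].
  + refine (@vanishes_foldr_const _ _ (face c 0) lam _ c 0 _ cr _) => v /eqP; exact: lam0.
  + apply: vanishes_foldr; apply: vanishes_head_mul0 => v /eqP v0.
    by rewrite /mu lam0 // lam'0 // addr0.
  + apply: vanishes_foldr; apply: vanishes_head_mul.
    refine (@vanishes_foldr_const _ _ (face c 0) lam _ c 0 _ cr _) => v /eqP; exact: lam0.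
- move=> c; have : c \in enum 'I_n by rewrite mem_enum.
  rewrite /cups_primitive /cups r12 mem_cat inE => /or3P[cr|/eqP ->|cr].
  + refine (@vanishes_foldr_const _ _ (face c p.+1) lam _ c 1 _ cr _) => v /eqP; exact: lamP.
  + apply: vanishes_foldr; apply: vanishes_head_mul0 => v /eqP v0.
    by rewrite /mu lamP // lam'P // addrr_F2.
  + apply: vanishes_foldr; apply: vanishes_head_mul.
    refine (@vanishes_foldr_const _ _ (face c p.+1) lam _ c 1 _ cr _) => v /eqP; exact: lamP.
Qed.

Definition top_face (i : 'I_n) (v : V) : 'F_2 := (v i == p.+1)%:R.

Lemma separating_top_face : separating top_face.
Proof. by split=> i v; rewrite /top_face => ->; rewrite ?eqxx. Qed.

Lemma degree_cupsE lam (x : simplex n p) :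
  cups (map lam (enum 'I_n)) (chain x) =
  \prod_(i < n) (lam i (vertex x i.+1) + lam i (vertex x i)).
Proof.
have szl : size (map lam (enum 'I_n)) = n by rewrite size_map size_enum_ord.
rewrite (@cupsE _ [ffun=> 0%N]) szl; last by rewrite size_map size_iota.
apply: eq_bigr => i _.
rewrite (nth_map i) ?size_enum_ord // nth_ord_enum.
by rewrite !(nth_map 0%N) ?size_iota ?nth_iota ?ltnS ?ltn_ord // ltnW.
Qed.

(** Only [x0] contributes: the factor for [i] is nonzero exactly when step [i] brings coordinate [i]
    to [p.+1], which forces [x.1 i = p] and [x.2 i = i]. *)
Lemma degree_top_face : degree top_face = 1.
Proof.
have pE (b : bool) : (p + b == p.+1)%N = b.
  by case: b; rewrite ?addn1 ?eqxx // addn0 ltn_eqF.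
pose x0 : simplex n p := ([ffun=> ord_max], 1%g).
rewrite /degree (bigD1 x0) //= degree_cupsE big1 ?big1 ?addr0 // => [x xx0|i _].
  rewrite degree_cupsE; apply/eqP; apply: contraNT xx0 => /prodf_neq0 xne.
  have {}xne i : x.1 i = ord_max /\ x.2 i = i.
    have := xne i isT; rewrite /top_face !ffunE.
    have := ltn_ord (x.1 i); rewrite ltnS leq_eqVlt => /orP[/eqP xi|xi].
      rewrite xi !pE ltnS; case: ltngtP => // xii _.
      by split; apply/val_inj.
    rewrite !ltn_eqF ?addr0 ?eqxx // (@leq_ltn_trans (x.1 i + 1)) ?leq_add2l ?leq_b1 //.
      by rewrite addn1 ltnS.
    by rewrite addn1 ltnS.
  case: x xne => q s xne; apply/eqP; congr (_, _).
    by apply/ffunP => i; rewrite ffunE; have [] := xne i.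
  by apply/permP => i; rewrite perm1; have [] := xne i.
by rewrite /top_face !ffunE perm1 /= ltnSn ltnn addn1 addn0 eqxx ltn_eqF // addr0.
Qed.

Lemma degree_separating lam : separating lam -> degree lam = 1.
Proof.
(* The labellings are replaced by [top_face] one index at a time. *)
move=> [lam0 lamP]; pose hyb (r : seq 'I_n) i := if i \in r then top_face i else lam i.
have [top0 topP] := separating_top_face.
have hyb_sep r : separating (hyb r).
  by split=> i v vi; rewrite /hyb; case: ifP => _; auto.
have deg_hyb r : degree (hyb r) = degree lam.
  elim: r => [|k r <-].
    by congr degree; apply/funext => i; rewrite /hyb in_nil.
  apply: (@degree_change _ _ k) => // i ik.
  by rewrite /hyb inE (negbTE ik).
rewrite -(deg_hyb (enum 'I_n)) -degree_top_face; congr degree.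
by apply/funext => i; rewrite /hyb mem_enum.
Qed.

Lemma vertex_le (x : simplex n p) j i : (vertex x j i <= p.+1)%N.
Proof.
rewrite ffunE; apply: (@leq_trans (x.1 i + 1)); first by rewrite leq_add2l leq_b1.
by rewrite addn1 ltn_ord.
Qed.

(** The degree is nonzero, so some simplex has a nonzero contribution, which is the product over [i]
    of the changes of label [i] along edge [i]. *)
Lemma kuhn_sperner (lam : 'I_n -> V -> bool) :
  (forall i (v : V), v i = 0%N -> lam i v = false) ->
  (forall i (v : V), v i = p.+1 -> lam i v = true) ->
  exists x : simplex n p, forall i, lam i (vertex x i.+1) != lam i (vertex x i).
Proof.
move=> lam0 lamP; pose nlam i v : 'F_2 := (lam i v)%:R.
have : degree nlam != 0.
  rewrite degree_separating ?oner_neq0 //.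
  by split=> i v vi; rewrite /nlam; [rewrite lam0|rewrite lamP].
apply: contra_neqP => /forallNP xN; apply: big1 => x _.
have /existsNP[i /negP] := xN x; rewrite negbK => /eqP xi.
by rewrite degree_cupsE (bigD1 i) //= /nlam xi addrr_F2 mul0r.
Qed.

End Degree.

(** * The Poincare-Miranda theorem *)

Lemma norm_rV_leP (R : realType) n (x : 'rV[R]_n) (e : R) :
  0 <= e -> (`|x| <= e <-> forall i, `|x 0 i| <= e).
Proof.
move=> e0; rewrite {1}/Num.Def.normr /= mx_normrE; split.
  by move=> /bigmax_leP[_ H] i; exact: (H (0, i)).
move=> H; apply/bigmax_leP; split=> // -[i j] _ /=.
by rewrite (ord1 i).
Qed.

Lemma norm_coord_le (R : realType) n (x : 'rV[R]_n) i : `|x 0 i| <= `|x|.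
Proof. by move: i; apply/norm_rV_leP. Qed.

Lemma continuous_normP (R : realType) (V W : normedModType R) (F : V -> W) x :
  {for x, continuous F} <->
  forall e : R, 0 < e -> exists2 d, 0 < d &
    forall y, `|y - x| < d -> `|F y - F x| < e.
Proof.
split=> [/cvgrPdist_lt Fx e e0|Fx].
  have /nbhs_normP[d d0 dF] := Fx e e0; exists d => // y yx.
  by rewrite distrC; apply: dF; rewrite /ball_ /= distrC.
apply/cvgrPdist_lt => e e0; have [d d0 dF] := Fx e e0.
apply/nbhs_normP; exists d => // y; rewrite /ball_ /= => yx.
by rewrite distrC; apply: dF; rewrite distrC.
Qed.

Lemma nbhs_ball_normP (R : realType) (V : normedModType R) (x : V) (A : set V) :
  nbhs x A <-> exists2 d, 0 < d & forall y, `|y - x| < d -> A y.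
Proof.
split=> [/nbhs_normP[d d0 dA]|[d d0 dA]].
  by exists d => // y yx; apply: dA; rewrite /ball_ /= distrC.
by apply/nbhs_normP; exists d => // y; rewrite /ball_ /= distrC; exact: dA.
Qed.

Lemma small_inv (R : realType) (e : R) : 0 < e ->
  exists N, forall k, (N <= k)%N -> k.+1%:R^-1 < e.
Proof.
move=> e0; have [N] := ltr_add_invr e0; rewrite add0r => Ne.
exists N => k Nk; apply: le_lt_trans Ne.
by rewrite lef_pV2 ?posrE ?ltr0Sn // ler_nat ltnS.
Qed.

Lemma compact_seq_cluster (R : realType) (V : normedModType R) (A : set V)
    (u : nat -> V) : compact A -> (forall k, A (u k)) ->
  exists2 x, A x & forall (e : R) N, 0 < e ->
    exists2 k, (N <= k)%N & `|u k - x| < e.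
Proof.
move=> cA Au; have [|x [Ax xu]] := cA (u @ \oo) _ _.
  by exists 0%N => // k _; exact: Au.
exists x => // e N e0.
have uN : (u @ \oo) [set u k | k in [set k | (N <= k)%N]].
  by exists N => // k Nk; exists k.
have xe : nbhs x [set y | `|y - x| < e] by apply/nbhs_ball_normP; exists e.
by have [_ [[k Nk <-] uk]] := xu _ _ uN xe; exists k.
Qed.

Lemma compact_cball (R : realType) n (a : 'rV[R]_n) (r : R) :
  compact [set x | `|x - a| <= r].
Proof.
have -> : [set x : 'rV[R]_n | `|x - a| <= r] = closed_ball_ Num.Def.normr a r.
  by apply/seteqP; split=> x; rewrite /closed_ball_ /= distrC.
apply: bounded_closed_compact; last exact: closed_closed_ball_.
exists (r + `|a|); split; first exact: num_real.
move=> M rM x; rewrite /closed_ball_ /= => xr.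
rewrite (le_trans _ (ltW rM)) // -[x](subrK a) (le_trans (ler_normD _ _)) //.
by rewrite lerD2r distrC.
Qed.

Section PoincareMiranda.
Variables (R : realType) (n : nat) (a : 'rV[R]_n) (r : R).
Hypothesis r0 : 0 < r.
Variable Psi : 'rV[R]_n -> 'rV[R]_n.
Hypothesis Psi_lo : forall (x : 'rV[R]_n) i,
  `|x - a| <= r -> x 0 i = a 0 i - r -> Psi x 0 i <= 0.
Hypothesis Psi_hi : forall (x : 'rV[R]_n) i,
  `|x - a| <= r -> x 0 i = a 0 i + r -> 0 <= Psi x 0 i.

(** The labels are the signs of the coordinates of [Psi] on a grid of mesh [r * 2 / p.+1]; on the
    simplex given by [kuhn_sperner] every coordinate takes both signs. *)
Lemma almost_zero (p : nat) : exists2 z, `|z - a| <= r & forall i,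
  (exists y, [/\ `|y - a| <= r, `|y - z| <= r * 2 / p.+1%:R & Psi y 0 i <= 0]) /\
  (exists y, [/\ `|y - a| <= r, `|y - z| <= r * 2 / p.+1%:R & 0 <= Psi y 0 i]).
Proof.
have p0 : 0 < p.+1%:R :> R by rewrite ltr0Sn.
have rp0 : 0 <= r * 2 / p.+1%:R by rewrite divr_ge0 ?mulr_ge0 ?ltW.
pose pt (v : {ffun 'I_n -> nat}) : 'rV[R]_n :=
  \row_i (a 0 i - r + r * 2 / p.+1%:R * (v i)%:R).
(* The labels at [0] and [p.+1] are imposed: [kuhn_sperner] asks for them at every [v], even outside
   the cube, and [Psi] may vanish on the upper side. *)
pose lam i (v : {ffun _ -> _}) := if v i == 0%N then false else
  if v i == p.+1 then true else 0 < Psi (pt v) 0 i.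
have [i v v0|i v vp|x lamx] := @kuhn_sperner n p lam; rewrite /lam.
- by rewrite v0.
- by rewrite vp eqxx.
have in_ball j : `|pt (vertex x j) - a| <= r.
  apply/norm_rV_leP; first exact: ltW.
  move=> i; rewrite !mxE; set t := _ * _%:R.
  have t0 : 0 <= t by rewrite mulr_ge0.
  have tr : t <= r * 2.
    by rewrite /t mulrAC ler_pdivrMr // ler_pM2l ?mulr_gt0 // ler_nat vertex_le.
  by rewrite ler_norml; apply/andP; split; lra.
have near0 j : `|pt (vertex x j) - pt (vertex x 0)| <= r * 2 / p.+1%:R.
  apply/norm_rV_leP => // i; rewrite !mxE !ffunE ltn0 addn0 natrD mulrDr.
  set t := r * 2 / _; set s := t * _.
  rewrite (_ : _ - _ = t * (x.2 i < j)%:R); last by ring.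
  by case: (_ < _)%N; rewrite ?mulr1 ?mulr0 ?normr0 // ger0_norm.
have lamF j i : lam i (vertex x j) = false -> Psi (pt (vertex x j)) 0 i <= 0.
  rewrite /lam; case: eqP => [v0 _|_].
    by apply: Psi_lo => //; rewrite mxE v0 mulr0 addr0.
  by case: ifP => // _ /negbT; rewrite -leNgt.
have lamT j i : lam i (vertex x j) = true -> 0 <= Psi (pt (vertex x j)) 0 i.
  rewrite /lam; case: eqP => [//|_]; case: eqP => [vp _|_ /ltW //].
  apply: Psi_hi => //; rewrite mxE vp divfK ?lt0r_neq0 //; ring.
exists (pt (vertex x 0)) => // i.
have := lamx i; case l1 : (lam i _); case l0 : (lam i _) => // _; split.
- by exists (pt (vertex x i)); split => //; exact: lamF.
- by exists (pt (vertex x i.+1)); split => //; exact: lamT.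
- by exists (pt (vertex x i.+1)); split => //; exact: lamF.
- by exists (pt (vertex x i)); split => //; exact: lamT.
Qed.

(** At a cluster point of the approximate zeros, a nonzero coordinate of [Psi] would keep its sign
    on a neighbourhood that contains points of both signs. *)
Lemma poincare_miranda :
  (forall x : 'rV[R]_n, `|x - a| <= r -> {for x, continuous Psi}) ->
  exists2 x, `|x - a| <= r & Psi x = 0.
Proof.
move=> Psi_cont.
have [u uP] := choice (fun p => (exists2P _ _).1 (almost_zero p)).
have [//|x xr xu] := compact_seq_cluster (@compact_cball R n a r) (u := u).
  by move=> k; have [] := uP k.
exists x => //; apply/rowP => i; rewrite mxE.
have near (e : R) : 0 < e -> exists k, forall y, `|y - u k| <= r * 2 / k.+1%:R ->
    `|Psi y 0 i - Psi x 0 i| < e.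
  move=> e0; have /continuous_normP/(_ _ e0)[d d0 dPsi] := Psi_cont x xr.
  have [N NP] : exists N, forall k, (N <= k)%N -> k.+1%:R^-1 < d / 2 / (r * 2).
    by apply: small_inv; rewrite !divr_gt0 // mulr_gt0.
  have d20 : 0 < d / 2 by rewrite divr_gt0.
  have [k Nk kx] := xu (d / 2) N d20.
  exists k => // y yu; apply: le_lt_trans (dPsi y _).
    by rewrite -[X in `|X|](_ : (Psi y - Psi x) 0 i = _) ?norm_coord_le // !mxE.
  rewrite -(subrK (u k) y) -addrA (le_lt_trans (ler_normD _ _)) //.
  rewrite [ltRHS]splitr ler_ltD //; apply: (le_trans yu).
  by have /ltW := NP _ Nk; rewrite ler_pdivlMr ?mulr_gt0 // mulrC.
apply/eqP; rewrite eq_le; apply/andP; split; rewrite leNgt; apply/negP => Px.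
- have [k kP] := near _ Px; have [_ /(_ i)[[y [_ yu Py]] _]] := uP k.
  by have := kP y yu; rewrite ltr_norml => /andP[]; lra.
- have mPx : 0 < - Psi x 0 i by rewrite oppr_gt0.
  have [k kP] := near _ mPx; have [_ /(_ i)[_ [y [_ yu Py]]]] := uP k.
  by have := kP y yu; rewrite ltr_norml => /andP[]; lra.
Qed.

End PoincareMiranda.

(** * Invariance of domain *)

Lemma norm_fst_le (R : realType) (V W : normedModType R) (x : V * W) :
  `|x.1| <= `|x|.
Proof. by rewrite prod_normE le_max lexx. Qed.

Lemma norm_snd_le (R : realType) (V W : normedModType R) (x : V * W) :
  `|x.2| <= `|x|.
Proof. by rewrite prod_normE le_max lexx orbT. Qed.

(** Uniform continuity of the inverse: pairs violating it cluster at some [(x, y)] with [F x = F y],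
    hence [x = y], although they stay [e] apart. *)
Lemma uniformly_injective (R : realType) (V W : normedModType R) (A : set V)
    (F : V -> W) :
  compact A -> (forall x, A x -> {for x, continuous F}) ->
  (forall x y, A x -> A y -> F x = F y -> x = y) ->
  forall e : R, 0 < e -> exists2 d : R, 0 < d &
    forall x y, A x -> A y -> `|F x - F y| < d -> `|x - y| < e.
Proof.
move=> cA Fcont Finj e e0; apply: contrapT => noD.
have bad k : exists u : V * V, [/\ A u.1, A u.2,
    `|F u.1 - F u.2| < k.+1%:R^-1 & e <= `|u.1 - u.2|].
  apply: contrapT => Nu; apply: noD; exists k.+1%:R^-1 => // x y Ax Ay Fxy.
  rewrite ltNge; apply/negP => exy; apply: Nu; by exists (x, y).
have [u uP] := choice bad.
have [k|[x y] [/= Ax Ay] xyu] := compact_seq_cluster (compact_setX cA cA) (u := u).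
  by have [] := uP k.
have close t N : 0 < t -> exists2 k, (N <= k)%N &
    `|(u k).1 - x| < t /\ `|(u k).2 - y| < t.
  move=> t0; have [k Nk uk] := xyu t N t0; exists k => //.
  have fst_le := norm_fst_le (u k - (x, y)).
  have snd_le := norm_snd_le (u k - (x, y)).
  by split; [apply: le_lt_trans fst_le uk|apply: le_lt_trans snd_le uk].
have xy : x = y.
  apply: Finj => //; apply/eqP; rewrite -subr_eq0 -normr_le0 leNgt; apply/negP => Fxy.
  have t0 : 0 < `|F x - F y| / 3 by rewrite divr_gt0.
  have /continuous_normP/(_ _ t0)[d1 d10 dF1] := Fcont x Ax.
  have /continuous_normP/(_ _ t0)[d2 d20 dF2] := Fcont y Ay.
  have [N NP] := small_inv t0.
  have d0 : 0 < Num.min d1 d2 by rewrite lt_min d10.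
  have [k Nk [u1 u2]] := close _ N d0.
  move: u1 u2; rewrite !lt_min => /andP[/dF1 H1 _] /andP[_ /dF2 H2].
  have [_ _ /lt_trans/(_ (NP k Nk)) H3 _] := uP k.
  have : `|F x - F y| <= `|F (u k).1 - F x| + `|F (u k).1 - F (u k).2|
      + `|F (u k).2 - F y|.
    rewrite [X in _ <= X + _ + _]distrC.
    apply: le_trans (lerD (ler_normD _ _) (lexx _)).
    apply: le_trans (ler_normD _ _).
    by rewrite !addrA !subrK.
  by lra.
subst y; have [k _ [u1 u2]] := close (e / 2) 0%N ltac:(by rewrite divr_gt0).
have [_ _ _] := uP k; apply/negP; rewrite -ltNge [ltRHS]splitr.
by rewrite -(subrK x (u k).1) -addrA (le_lt_trans (ler_normD _ _)) // ltrD // distrC.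
Qed.

(* McShane's inf-convolution, applied to the inverse of [F]. *)
Lemma lipschitz_left_inverse (R : realType) n (W : normedModType R)
    (a : 'rV[R]_n) (r : R) (F : 'rV[R]_n -> W) (e d : R) :
  0 < r -> 0 < e -> 0 < d ->
  (forall x y, `|x - a| <= r -> `|y - a| <= r -> `|F x - F y| < d ->
    `|x - y| < e) ->
  exists (G : W -> 'rV[R]_n) (L : R),
    [/\ 0 < L, forall y z, `|G y - G z| <= L * `|y - z| &
      forall x, `|x - a| <= r -> `|G (F x) - x| <= e].
Proof.
(* [L * d] exceeds the width [r * 2] of the cube, so a point [z] with [F z] at distance at least [d]
   from [F x] cannot lower the infimum below [x 0 i]. *)
move=> r0 e0 d0 FI; pose L := r * 2 / d + 1.
have L0 : 0 < L by rewrite addr_gt0 // divr_gt0 // mulr_gt0.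
pose E y i := [set x 0 i + L * `|y - F x| | x in [set x | `|x - a| <= r]].
have coord (x : 'rV[R]_n) i : `|x - a| <= r -> a 0 i - r <= x 0 i <= a 0 i + r.
  move=> xr; have := le_trans (norm_coord_le (x - a) i) xr; rewrite !mxE ler_norml.
  by move=> /andP[? ?]; apply/andP; split; lra.
have aE y i : E y i !=set0.
  by exists (a 0 i + L * `|y - F a|), a => //=; rewrite subrr normr0 ltW.
have lbE y i : has_lbound (E y i).
  exists (a 0 i - r) => _ [x /= /(coord _ i)/andP[xr _] <-].
  by rewrite (le_trans xr) // lerDl mulr_ge0 // ltW.
exists (fun y => \row_i inf (E y i)), L; split => //.
  have half y z i : inf (E y i) <= inf (E z i) + L * `|y - z|.
    rewrite -lerBlDr; apply: lb_le_inf => // _ [x /= xr <-].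
    rewrite lerBlDr -addrA -mulrDr (le_trans (ge_inf (lbE y i) (x := x 0 i + L * `|y - F x|) _)) //.
      by exists x.
    by rewrite lerD2l ler_pM2l // [leRHS]addrC -(subrKA z y) ler_normD.
  move=> y z; apply/norm_rV_leP; first by rewrite mulr_ge0 // ltW.
  move=> i; have := half z y i; have := half y z i.
  by rewrite !mxE ler_norml distrC => ? ?; apply/andP; split; lra.
move=> x xr; apply/norm_rV_leP; first exact: ltW.
move=> i; rewrite !mxE ler_norml; apply/andP; split.
  rewrite lerBrDr; apply: lb_le_inf => // _ [z /= zr <-].
  have [Fxz|Fxz] := ltP `|F x - F z| d.
    have := norm_coord_le (x - z) i; rewrite !mxE => /le_lt_trans/(_ (FI _ _ xr zr Fxz)).
    have : 0 <= L * `|F x - F z| by rewrite mulr_ge0 // ltW.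
    by rewrite ltr_norml => ? /andP[? ?]; lra.
  have : L * d <= L * `|F x - F z| by rewrite ler_pM2l.
  rewrite {1}/L mulrDl divfK ?gt_eqF // mul1r.
  have /andP[? ?] := coord z i zr; have /andP[? ?] := coord x i xr.
  by move=> ?; lra.
rewrite lerBlDr (le_trans (ge_inf (lbE _ i) (x := x 0 i) _)) ?lerDr ?ltW //.
by exists x => //; rewrite subrr normr0 mulr0 addr0.
Qed.

(* The sphere splits into at most [2 (m + 1) (K M + 1)^m] cells on each of which
   a Lipschitz map moves less than the spacing [eta / M] of the [(M + 1)^(m + 1)]
   points of a grid, so some grid point is missed once [M] is large. *)
Lemma lipschitz_sphere_avoids (R : realType) m
    (G : 'rV[R]_m.+1 -> 'rV[R]_m.+1) (L : R) (c : 'rV[R]_m.+1) (s eta : R) :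
  0 < L -> (forall y z, `|G y - G z| <= L * `|y - z|) ->
  0 < s -> 0 < eta ->
  exists2 w, `|w| <= eta & forall y, `|y - c| = s -> G y != w.
Proof.
move=> L0 GL s0 eta0; apply: contrapT => noW.
have hit w : `|w| <= eta -> exists2 y, `|y - c| = s & G y = w.
  move=> weta; apply: contrapT => Ny; apply: noW; exists w => // y ys.
  by apply/eqP => Gy; apply: Ny; exists y.
(* With [N = K * M], [L] times the cell size [s * 2 / N] is below the grid spacing [eta / M]. *)
pose K := (Num.truncn (L * (s * 2) / eta)).+1.
have KP : L * (s * 2) / eta < K%:R.
  by have /andP[] := @truncn_itv R (L * (s * 2) / eta)
    ltac:(by rewrite divr_ge0 ?mulr_ge0 // ltW).
pose M := (2 * m.+1 * K ^ m)%N.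
have M0 : (0 < M)%N by rewrite !muln_gt0 expn_gt0.
pose N := (K * M)%N.
have N0 : 0 < N%:R :> R by rewrite ltr0n muln_gt0.
have MR0 : 0 < M%:R :> R by rewrite ltr0n.
have s20 : 0 < s * 2 by rewrite mulr_gt0.
have sN0 : 0 <= s * 2 / N%:R by rewrite ltW // divr_gt0.
(* A side of the cube, given by a coordinate and a sign, with the integer parts of the other
   rescaled coordinates; [N] itself occurs among these, whence ['I_N.+1]. *)
pose cell := ('I_m.+1 * bool * {ffun 'I_m -> 'I_N.+1})%type.
pose in_cell (y : 'rV[R]_m.+1) (z : cell) :=
  y 0 z.1.1 = c 0 z.1.1 + (if z.1.2 then s else - s) /\
  forall j, (z.2 j)%:R <= (y 0 (lift z.1.1 j) - c 0 (lift z.1.1 j) + s) * N%:R / (s * 2)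
            < (z.2 j).+1%:R.
have cellP y : `|y - c| = s -> exists z, in_cell y z.
  move=> ys; have : mx_norm (y - c) != 0 by rewrite -[mx_norm _]/`|y - c| ys gt_eqF.
  move=> /mx_norm_neq0[[k i] +]; rewrite (ord1 k) /= !mxE -[mx_norm _]/`|y - c| ys => yi.
  have tP j : 0 <= (y 0 j - c 0 j + s) * N%:R / (s * 2) <= N%:R.
    have := norm_coord_le (y - c) j; rewrite ys !mxE ler_norml => /andP[y1 y2].
    have z0 : 0 <= y 0 j - c 0 j + s by lra.
    rewrite (divr_ge0 (mulr_ge0 z0 (ltW N0)) (ltW s20)) /=.
    by rewrite ler_pdivrMr // mulrC ler_pM2l //; lra.
  exists (i, c 0 i <= y 0 i,
    [ffun j => inord (Num.truncn ((y 0 (lift i j) - c 0 (lift i j) + s) * N%:R / (s * 2)))]).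
  split=> [/=|j /=].
    move: yi; have [cy|cy] := leP (c 0 i) (y 0 i).
      by rewrite ger0_norm ?subr_ge0 // => yi; lra.
    by rewrite ltr0_norm ?subr_lt0 // => yi; lra.
  have /andP[t0 tN] := tP (lift i j).
  by rewrite ffunE inordK ?truncn_itv // ltnS -(ler_nat R) (le_trans _ tN) // truncn_le.
have same_cell y y' z : in_cell y z -> in_cell y' z -> `|y - y'| <= s * 2 / N%:R.
  move=> [yi yj] [y'i y'j]; apply/norm_rV_leP => //.
  move=> k; rewrite !mxE; case: (unliftP z.1.1 k) => [j ->|->]; last first.
    by rewrite yi y'i subrr normr0.
  have /andP[a1 a2] := yj j; have /andP[b1 b2] := y'j j.
  have unscale t : t = t * N%:R / (s * 2) * (s * 2 / N%:R).
    by field; rewrite !gt_eqF.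
  rewrite (_ : _ - _ = (y 0 (lift z.1.1 j) - c 0 (lift z.1.1 j) + s)
    - (y' 0 (lift z.1.1 j) - c 0 (lift z.1.1 j) + s)); last by ring.
  rewrite [X in `|X - _|]unscale [X in `|_ - X|]unscale -mulrBl normrM.
  rewrite (ger0_norm sN0) (ler_piMl sN0) // ler_norml.
  by move: a1 a2 b1 b2; rewrite -!natr1 => ? ? ? ?; apply/andP; split; lra.
have etaM0 : 0 < eta / M%:R by rewrite divr_gt0.
pose w (k : {ffun 'I_m.+1 -> 'I_M.+1}) : 'rV[R]_m.+1 := \row_i (eta / M%:R * (k i)%:R).
have weta k : `|w k| <= eta.
  apply/norm_rV_leP; first exact: ltW.
  move=> i; rewrite mxE (ger0_norm (mulr_ge0 (ltW etaM0) _)) //.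
  by rewrite mulrAC ler_pdivrMr // ler_pM2l // ler_nat -ltnS ltn_ord.
have wz k : exists z, exists2 y, in_cell y z & G y = w k.
  by have [y /cellP[z yz] Gy] := hit _ (weta k); exists z, y.
have [phi phiP] := choice wz.
have phi_inj : injective phi.
  move=> k k' kk'; have [y yz Gy] := phiP k; have [y' yz' Gy'] := phiP k'.
  apply/ffunP => i; apply/eqP; apply: contraT => ki.
  have : eta / M%:R <= `|w k - w k'|.
    apply: le_trans (norm_coord_le _ i); rewrite !mxE -mulrBr normrM.
    rewrite gtr0_norm // (ler_peMr (ltW etaM0)) //.
    move: ki; rewrite -val_eqE /= neq_ltn -!(ler_nat R) -!natr1 ler_normr.
    by case/orP => ?; apply/orP; [right|left]; lra.
  rewrite -Gy -Gy' leNgt => /negP[].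
  apply: le_lt_trans (GL _ _) _; rewrite kk' in yz.
  apply: (@le_lt_trans _ _ (L * (s * 2 / N%:R))).
    by rewrite ler_pM2l // (same_cell _ _ _ yz).
  rewrite mulrA ltr_pdivrMr // /N natrM.
  rewrite (_ : _ / _ * _ = K%:R * eta); last by field; rewrite gt_eqF.
  by rewrite -ltr_pdivrMr.
have := leq_card phi phi_inj; rewrite !card_prod !card_ffun !card_ord card_bool.
rewrite leqNgt => /negP; apply.
have KM : (N.+1 <= K * M.+1)%N by rewrite mulnS -addn1 addnC leq_add2r.
apply: (@leq_ltn_trans (m.+1 * 2 * (K * M.+1) ^ m)).
  by rewrite leq_mul2l; case: (m) => // e; rewrite leq_exp2r // KM orbT.
rewrite expnS expnMn mulnA ltn_pmul2r ?expn_gt0 // ltnS /M.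
by rewrite [(2 * _)%N]mulnC.
Qed.

(** The map fixes the points at distance at least [s] from [c] and pushes nearer ones out to the
    sphere of radius [s]. *)
Lemma continuous_radial_push (R : realType) (V : normedModType R) (c y : V) (s : R) :
  y != c ->
  {for y, continuous (fun y => c + Num.max 1 (s / `|y - c|) *: (y - c))}.
Proof.
move=> yc; have yc0 : `|y - c| != 0 by rewrite normr_eq0 subr_eq0.
have cvgBc : (z - c) @[z --> y] --> y - c by apply: cvgB; [exact: cvg_id|exact: cvg_cst].
apply: cvgD; first exact: cvg_cst.
apply: cvgZ => //; apply: (@continuous_max R _ (fun=> 1) (fun z => s / `|z - c|)).
  exact: cvg_cst.
by apply: cvgM; [exact: cvg_cst|apply: cvgV => //; exact: cvg_norm].
Qed.

Lemma continuous_subr_cst (R : realType) (T : topologicalType) (V : normedModType R)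
    (f : T -> V) (b : V) (x : T) :
  {for x, continuous f} -> {for x, continuous (fun y => f y - b)}.
Proof. by move=> fx; apply: cvgB => //; exact: cvg_cst. Qed.

Lemma lipschitz_continuous (R : realType) (V W : normedModType R) (G : V -> W) (L : R) :
  0 < L -> (forall y z, `|G y - G z| <= L * `|y - z|) -> continuous G.
Proof.
move=> L0 GL y; apply/continuous_normP => e e0; exists (e / L); first exact: divr_gt0.
by move=> z zy; rewrite (le_lt_trans (GL _ _)) // mulrC -ltr_pdivlMr.
Qed.

(* Invariance of domain, after Kulpa: if [F a] were not interior to the image,
   the projection away from a nearby point [c] outside of the image, followed by
   a perturbed Lipschitz left inverse of [F], would have no zero. *)
Lemma image_nbhs_nondegenerate (R : realType) m (a : 'rV[R]_m.+1) (r : R)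
    (F : 'rV[R]_m.+1 -> 'rV[R]_m.+1) :
  0 < r ->
  (forall x, `|x - a| <= r -> {for x, continuous F}) ->
  (forall x y, `|x - a| <= r -> `|y - a| <= r -> F x = F y -> x = y) ->
  exists2 rho : R, 0 < rho &
    forall v, `|v - F a| <= rho -> exists2 x, `|x - a| <= r & F x = v.
Proof.
move=> r0 Fcont Finj.
have UI := uniformly_injective (@compact_cball R _ a r) Fcont Finj.
have ar : `|a - a| <= r by rewrite subrr normr0 ltW.
have [d0 d00 d0P] := UI r r0.
pose rho := d0 / 4; have rho0 : 0 < rho by rewrite divr_gt0.
exists rho => // c cF; apply: contrapT => noX.
have cNF x : `|x - a| <= r -> F x != c.
  by move=> xr; apply/eqP => Fx; apply: noX; exists x.
(* [s] is half of [d0]: images of boundary points stay at distance at least [s] from [c], while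
   [F a] is within [s / 2] of it. *)
pose s := rho * 2; have s0 : 0 < s by rewrite mulr_gt0.
have far x : `|x - a| <= r -> r <= `|x - a| -> s <= `|F x - c|.
  move=> xr rx; rewrite leNgt; apply/negP => Fxs.
  have : `|F x - F a| < d0.
    rewrite -(subrK c (F x)) -addrA (le_lt_trans (ler_normD _ _)) //.
    rewrite (lt_le_trans (ltr_leD Fxs cF)) // /s /rho; lra.
  by move=> /(d0P _ _ xr ar); rewrite ltNge rx.
have /continuous_normP/(_ _ rho0)[eta eta0 etaP] := Fcont a ar.
have off_center x : s <= `|F x - c| -> eta <= `|x - a|.
  move=> sF; rewrite leNgt; apply/negP => /etaP Fx.
  have := ler_normD (F x - F a) (F a - c); rewrite addrA subrK distrC [`|F a - c|]distrC.
  by rewrite [`|c - F x|]distrC => H; move: sF H cF Fx; rewrite /s; lra.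
(* Where [Phi] is the identity, [Psi x] differs from [x - a] by at most [e * 2]: the bound by [r]
   gives the boundary signs, the bound by [eta] puts such zeros within [eta] of [a]. *)
pose e := Num.min r eta / 4.
have [er eeta] : e <= r / 4 /\ e <= eta / 4.
  by rewrite !ler_pM2r ?invr_gt0 // !ge_min !lexx orbT.
have e0 : 0 < e by rewrite divr_gt0 // lt_min r0.
have [d d00' dP] := UI e e0.
have [G [L [L0 GL GF]]] := lipschitz_left_inverse r0 e0 d00' dP.
have [w we wP] : exists2 w, `|w| <= e & forall y, `|y - c| = s -> G y - a != w.
  apply: (@lipschitz_sphere_avoids _ _ (fun y => G y - a) L c s e L0 _ s0 e0) => y z.
  by rewrite opprB addrA subrK.
pose Phi y := c + Num.max 1 (s / `|y - c|) *: (y - c).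
have Phi_out y : s <= `|y - c| -> Phi y = y.
  move=> sy; rewrite /Phi max_l ?scale1r ?subrKC //.
  by rewrite ler_pdivrMr ?mul1r // (lt_le_trans s0).
have Phi_in y : y != c -> `|y - c| < s -> `|Phi y - c| = s.
  move=> yc ys; have yc0 : 0 < `|y - c| by rewrite normr_gt0 subr_eq0.
  rewrite /Phi max_r; last by rewrite ler_pdivlMr // mul1r ltW.
  by rewrite addrC addKr normrZ gtr0_norm ?divr_gt0 // divfK // gt_eqF.
pose Psi x := G (Phi (F x)) - a - w.
have bd x i : `|x - a| <= r -> r <= `|x - a| ->
    `|Psi x 0 i - (x 0 i - a 0 i)| <= r.
  move=> xr rx; rewrite /Psi Phi_out ?far // !mxE.
  have := norm_coord_le (G (F x) - x) i; have := norm_coord_le w i.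
  rewrite !mxE => /le_trans/(_ we) wi /le_trans/(_ (GF x xr)) gi.
  move: wi gi; rewrite !ler_norml => /andP[? ?] /andP[? ?].
  by apply/andP; split; lra.
have Psi_cont x : `|x - a| <= r -> {for x, continuous Psi}.
  move=> xr; apply: (@continuous_subr_cst _ _ _ (fun x => G (Phi (F x)) - a)).
  apply: (@continuous_subr_cst _ _ _ (fun x => G (Phi (F x)))).
  apply: (@continuous_comp _ _ _ (Phi \o F) G); last exact: lipschitz_continuous GL _.
  apply: (@continuous_comp _ _ _ F Phi); first exact: Fcont.
  by apply: continuous_radial_push; exact: cNF.
have sphere (x : 'rV[R]_m.+1) i : x 0 i = a 0 i - r \/ x 0 i = a 0 i + r -> r <= `|x - a|.
  move=> xi; apply: le_trans (norm_coord_le _ i); rewrite !mxE ler_normr.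
  by apply/orP; case: xi => ->; [right|left]; lra.
have [x i xr xi|x i xr xi|//|x xr Px] := @poincare_miranda R _ a r r0 Psi.
- have := bd x i xr (sphere x i (or_introl xi)); rewrite xi ler_norml => /andP[? ?]; lra.
- have := bd x i xr (sphere x i (or_intror xi)); rewrite xi ler_norml => /andP[? ?]; lra.
(* If [F x] is closer than [s] to [c], it is pushed onto the sphere, where the value [w] is avoided;
   otherwise [x] is too close to [a] for [off_center]. *)
have [Fxs|Fxs] := leP s `|F x - c|; last first.
  have := wP _ (Phi_in _ (cNF x xr) Fxs).
  by rewrite -subr_eq0 -/(Psi x) Px eqxx.
move: Px; rewrite /Psi Phi_out // => /eqP; rewrite subr_eq0 => /eqP Gw.
have := off_center x Fxs; have := GF x xr.
have : `|x - a| <= `|G (F x) - x| + `|G (F x) - a|.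
  by rewrite [X in _ <= X + _]distrC -(subrKA (G (F x)) x) ler_normD.
by rewrite Gw; lra.
Qed.

(** [F] has a continuous inverse [G] near [F a], and [F' (G y)] stays close to [y]; Poincare-Miranda
    solves [F' (G y) = v] on a cube whose size does not depend on [F']. *)
Lemma stable_image_nbhs (R : realType) n (a : 'rV[R]_n) (r : R)
    (F : 'rV[R]_n -> 'rV[R]_n) :
  0 < r ->
  (forall x, `|x - a| <= r -> {for x, continuous F}) ->
  (forall x y, `|x - a| <= r -> `|y - a| <= r -> F x = F y -> x = y) ->
  exists2 rho : R, 0 < rho & forall F' : 'rV[R]_n -> 'rV[R]_n,
    (forall x, `|x - a| <= r -> {for x, continuous F'}) ->
    (forall x, `|x - a| <= r -> `|F' x - F x| <= rho) ->
    forall v, `|v - F a| <= rho -> exists2 x, `|x - a| <= r & F' x = v.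
Proof.
move=> r0 Fcont Finj; have ar : `|a - a| <= r by rewrite subrr normr0 ltW.
case: n => [|m] in a F Fcont Finj ar *.
  by exists 1 => // F' _ _ v _; exists a => //; rewrite [LHS]thinmx0 [RHS]thinmx0.
have UI := uniformly_injective (@compact_cball R _ a r) Fcont Finj.
have [rho0 rho00 img] := image_nbhs_nondegenerate r0 Fcont Finj.
have [G GP] : {G : 'rV[R]_m.+1 -> 'rV[R]_m.+1 & forall y, `|y - F a| <= rho0 ->
    `|G y - a| <= r /\ F (G y) = y}.
  apply: (@choice _ _ (fun y x => `|y - F a| <= rho0 -> `|x - a| <= r /\ F x = y)) => y.
  have [/img[x xr Fx]|] := boolP (`|y - F a| <= rho0).
    by exists x.
  by exists a.
exists (rho0 / 4); first by rewrite divr_gt0.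
move=> F' F'cont F'F v vF.
(* Half the radius leaves room around the cube for the continuity of [G]; on its sides the two
   errors, each at most [rho0 / 4], do not spoil the signs. *)
have R0 : 0 < rho0 / 2 by rewrite divr_gt0.
pose Psi y := F' (G y) - v.
have close y : `|y - F a| <= rho0 / 2 -> `|y - F a| <= rho0.
  by move/le_trans; apply; lra.
have bd y i : `|y - F a| <= rho0 / 2 -> `|Psi y 0 i - (y 0 i - F a 0 i)| <= rho0 / 2.
  move=> /close/GP[Gr FG]; have := norm_coord_le (F' (G y) - F (G y)) i.
  have := norm_coord_le (v - F a) i; rewrite FG !mxE.
  have := F'F _ Gr; rewrite FG => H /le_trans/(_ vF) v1 /le_trans/(_ H).
  by move: v1; rewrite !ler_norml => /andP[? ?] /andP[? ?]; apply/andP; split; lra.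
have Psi_cont y : `|y - F a| <= rho0 / 2 -> {for y, continuous Psi}.
  move=> yF; apply: (@continuous_subr_cst _ _ _ (F' \o G)).
  have [Gr FG] := GP _ (close _ yF).
  apply: (@continuous_comp _ _ _ G F'); last exact: F'cont.
  apply/continuous_normP => e e0; have [d d0 dP] := UI e e0.
  exists (Num.min d (rho0 / 2)); first by rewrite lt_min d0.
  move=> z; rewrite lt_min => /andP[zd zr].
  have [Gzr FGz] : `|G z - a| <= r /\ F (G z) = z.
    apply: GP; rewrite -(subrK y z) -addrA (le_trans (ler_normD _ _)) //; lra.
  by apply: dP => //; rewrite FG FGz.
have [y i yr yi|y i yr yi|//|y yr Py] := @poincare_miranda R _ (F a) _ R0 Psi.
- by have := bd y i yr; rewrite yi ler_norml => /andP[? ?]; lra.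
- by have := bd y i yr; rewrite yi ler_norml => /andP[? ?]; lra.
exists (G y); first by have [] := GP _ (close _ yr).
by apply/eqP; rewrite -subr_eq0; apply/eqP.
Qed.

(** * Continuously differentiable maps *)

Lemma is_diff_coord (R : realType) m n (M : 'M[R]_(m, n)) i j :
  is_diff M (fun N : 'M[R]_(m, n) => N i j : R^o) (fun N => N i j).
Proof.
have cl : linear (fun N : 'M[R]_(m, n) => N i j : R^o).
  by move=> k u v; rewrite !mxE.
pose clM := GRing.isLinear.Build _ _ _ _ _ cl.
pose cL : {linear _ -> _} := HB.pack (fun N : 'M[R]_(m, n) => N i j : R^o) clM.
have -> : (fun N : 'M[R]_(m, n) => N i j : R^o) = cL by [].
apply: DiffDef; first exact/linear_differentiable/coord_continuous.
by rewrite diff_lin //; exact: coord_continuous.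
Qed.

(* The mean value theorem, coordinatewise along the segment from [a] to [b]. *)
Lemma C1_strictly_differentiable (R : realType) (U : normedModType R) n
    (f : U -> 'rV[R]_n) (z : U) (e : R) :
  is_C1 f -> 0 < e -> exists2 d : R, 0 < d &
    forall a b, `|a - z| < d -> `|b - z| < d ->
      `|f b - f a - 'd f z (b - a)| <= e * `|b - a|.
Proof.
move=> [f_diff f_C] e0.
have /nbhs_ball_normP[d d0 dP] := f_C z e e0; exists d => // a b az bz.
have seg (t : R) : 0 <= t <= 1 -> `|a + t *: (b - a) - z| < d.
  move=> /andP[t0 t1].
  have -> : a + t *: (b - a) - z = (1 - t) *: (a - z) + t *: (b - z).
    rewrite scalerBl scale1r addrAC -[RHS]addrA; congr (_ + _).
    by rewrite [RHS]addrC -scalerBr opprB addrA subrK.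
  have [->|tn0] := eqVneq t 0; first by rewrite subr0 scale1r scale0r addr0.
  rewrite (le_lt_trans (ler_normD _ _)) // !normrZ ger0_norm ?subr_ge0 // ger0_norm //.
  rewrite (_ : d = (1 - t) * d + t * d); last by ring.
  rewrite ler_ltD ?ler_wpM2l ?subr_ge0 // ?ltW // ltr_pM2l // lt_neqAle eq_sym tn0 //.
apply/norm_rV_leP; first by rewrite mulr_ge0 // ltW.
move=> i; pose l (t : R^o) : U := a + t *: (b - a).
pose phi (t : R^o) : R^o := f (l t) 0 i - t * ('d f z (b - a) 0 i).
have l_diff t : is_diff t l ( *:%R^~ (b - a)).
  have := is_diffD (is_diff_cst a t) (is_diff_scalel t (b - a)).
  by rewrite add0r.
have fl_diff t : is_diff t (fun t => f (l t) 0 i : R^o)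
    (fun s : R^o => 'd f (l t) (s *: (b - a)) 0 i : R^o).
  have fd : is_diff (l t) f ('d f (l t)) by apply: DiffDef.
  exact: is_diff_comp (is_diff_comp (l_diff t) fd) (is_diff_coord _ _ _).
have phi_diff t : is_diff t phi
    (fun s : R^o => 'd f (l t) (s *: (b - a)) 0 i - s * ('d f z (b - a) 0 i) : R^o).
  exact: is_diffB (fl_diff t) (is_diff_scalel t ('d f z (b - a) 0 i : R^o)).
have phi_der t : is_derive t (1 : R^o) phi (('d f (l t) (b - a) - 'd f z (b - a)) 0 i).
  have pd := phi_diff t; apply: DeriveDef; first exact: diff_derivable.
  by rewrite deriveE // diff_val !mxE scale1r mul1r.
have [|c] := @MVT_segment R phi _ 0 1 ler01 (fun t _ => phi_der t).
  apply: continuous_subspaceT => t; apply: differentiable_continuous.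
  by have [] := phi_diff t.
rewrite in_itv /= subr0 mulr1 => c01 phi01.
have -> : (f b - f a - 'd f z (b - a)) 0 i = phi 1 - phi 0.
  by rewrite /phi /l !mxE scale1r scale0r addr0 subrKC mul1r mul0r subr0; ring.
rewrite phi01 (le_trans (norm_coord_le _ i)) //.
by apply: dP; exact: seg.
Qed.

Lemma diff_partial (R : realType) (P U V : normedModType R) (h : P * U -> V)
    (p : P) (x : U) (u : U) :
  differentiable h (p, x) -> 'd (fun x => h (p, x)) x u = 'd h (p, x) (0, u).
Proof.
move=> hd.
have pd : is_diff x (fun y : U => (p, y)) (fun u => (0, u)).
  exact: is_diff_pair (is_diff_cst p x) (is_diff_id x).
have hp : is_diff (p, x) h ('d h (p, x)) by apply: DiffDef.
have -> : 'd (fun x => h (p, x)) x = 'd h (p, x) \o (fun u => (0, u)) :> (_ -> _).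
  exact: @diff_val _ _ _ _ _ _ (is_diff_comp pd hp).
by [].
Qed.

(** * Generalized equations *)

Lemma localization_unique (R : realType) (U V : normedModType R) (S : U -> set V)
    (z : U) (w : V) (Z : set U) (W : set V) (s : U -> V) :
  single_valued_localization S z w Z W s ->
  forall u x, Z u -> W x -> S u x -> x = s u.
Proof.
move=> [_ _ _ gphE] u x Zu Wx Sux.
have : ((Z `*` W) `&` gph S) (u, x) by [].
by rewrite -gphE => -[u' _ [-> ->]].
Qed.

Lemma cvg_section (T U V : topologicalType) (F : set_system T) (p : U)
    (f : T -> V) (x : V) :
  Filter F -> f @ F --> x -> (p, f k) @[k --> F] --> (p, x).
Proof. by move=> FF fx; apply: cvg_pair => //; exact: cvg_cst. Qed.

Lemma lipschitz_boundP (R : realType) (U V : normedModType R) (A : set U)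
    (s : U -> V) : [lipschitz s u | u in A] ->
  exists2 M : R, 0 < M & forall u v, A u -> A v -> `|s u - s v| <= M * `|u - v|.
Proof.
move=> [M [_ MP]]; exists (Num.max (M + 1) 1); first by rewrite lt_max ltr01 orbT.
move=> u v Au Av; have : M < Num.max (M + 1) 1 by rewrite lt_max ltrDl ltr01.
by move=> /MP /(_ (u, v)); apply.
Qed.

(** * From a Lipschitz localization to the kernel condition *)

Section Generalized.
Variables (R : realType) (d n : nat).
Variables (H : 'rV[R]_n -> set 'rV[R]_n) (h : 'rV[R]_d * 'rV[R]_n -> 'rV[R]_n).
Variables (pb : 'rV[R]_d) (vb xb : 'rV[R]_n).
Hypothesis h_C1 : is_C1 h.
Let yb := vb - h (pb, xb).
Let D := 'd h (pb, xb).

Let D_lip : exists2 M : R, 0 < M & forall u, `|D u| <= M * `|u|.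
Proof. by apply: linear_lipschitz; apply: diff_continuous; case: h_C1. Qed.

(** [zk k] and [zt k] are solutions at [p = pb] whose values of [v] differ by o([t k]), by strict
    differentiability and [D (0, x') + y' = 0]. The Lipschitz bound forces [zk' k] to tend to 0. *)
Lemma localization_kernel :
  has_lipschitz_localization (solution_mapping h H) (pb, vb) xb ->
  forall x' y' : 'rV[R]_n, strict_graphical_derivative H xb yb x' y' ->
  D (0, x') + y' = 0 -> x' = 0.
Proof.
move=> [Z [W [s [sloc s_lip]]]] x' y'.
move=> [t [zk [wk [zk' [wk' [[t0 t_cvg] gphk [zk_cvg wk_cvg] [zk'_cvg wk'_cvg] Hk']]]]]] Dxy.
have [M M0 sM] := lipschitz_boundP s_lip; have sU := localization_unique sloc.
have [Zn Wn _ _] := sloc.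
have [K K0 DK] := D_lip.
apply/eqP; rewrite -normr_le0 leNgt; apply/negP => x'0.
(* Multiplied by [M], the strict differentiability error becomes half of the norm of [zk' k] and is
   absorbed. *)
have e0 : 0 < (M * 2)^-1 by rewrite invr_gt0 mulr_gt0.
have [del del0 hS] := C1_strictly_differentiable (pb, xb) h_C1 e0.
(* The final estimate bounds the norm of [x'] by [tau * (M * K * 2 + M * 2 + 1)], which is half of
   that norm. *)
pose tau := `|x'| / (M * K * 2 + M * 2 + 1) / 2.
have c0 : 0 < M * K * 2 + M * 2 + 1 by rewrite !addr_gt0 // !mulr_gt0.
have tau0 : 0 < tau by rewrite !divr_gt0.
pose zt k := zk k + t k *: zk' k.
pose wt k := wk k + t k *: wk' k.
have zt_cvg : zt @ \oo --> xb.
  by rewrite -[xb]addr0 -(scale0r x'); apply: cvgD => //; exact: cvgZ.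
have wt_cvg : wt @ \oo --> yb.
  by rewrite -[yb]addr0 -(scale0r y'); apply: cvgD => //; exact: cvgZ.
have hcont : {for (pb, xb), continuous h}.
  by apply: differentiable_continuous; case: h_C1.
have v_cvg (z w : nat -> 'rV[R]_n) : z @ \oo --> xb -> w @ \oo --> yb ->
    (pb, h (pb, z k) + w k) @[k --> \oo] --> (pb, vb).
  move=> zc wc; apply: cvg_section; rewrite -[vb](subrKC (h (pb, xb))).
  apply: cvgD => //; apply: (continuous_cvg _ hcont); exact: cvg_section.
near \oo => k.
have Zv : Z (pb, h (pb, zk k) + wk k) by near: k; exact: (v_cvg zk wk).
have Zv' : Z (pb, h (pb, zt k) + wt k) by near: k; exact: (v_cvg zt wt).
have Wz : W (zk k) by near: k; exact: zk_cvg.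
have Wz' : W (zt k) by near: k; exact: zt_cvg.
have z'tau : `|zk' k - x'| < tau.
  by near: k; apply: (zk'_cvg [set y | `|y - x'| < tau]); apply/nbhs_ball_normP; exists tau.
have w'tau : `|wk' k - y'| < tau.
  by near: k; apply: (wk'_cvg [set y | `|y - y'| < tau]); apply/nbhs_ball_normP; exists tau.
have zdel : `|(pb, zk k) - (pb, xb)| < del.
  by near: k; apply: (@cvg_section _ _ _ _ pb _ _ _ zk_cvg (fun y => `|y - (pb, xb)| < del));
    apply/nbhs_ball_normP; exists del.
have ztdel : `|(pb, zt k) - (pb, xb)| < del.
  by near: k; apply: (@cvg_section _ _ _ _ pb _ _ _ zt_cvg (fun y => `|y - (pb, xb)| < del));
    apply/nbhs_ball_normP; exists del.
have Szk : solution_mapping h H (pb, h (pb, zk k) + wk k) (zk k).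
  by exists (wk k) => //; exact: gphk.
have Szt : solution_mapping h H (pb, h (pb, zt k) + wt k) (zt k).
  by exists (wt k) => //; exact: Hk'.
have := sM _ _ Zv' Zv; rewrite -(sU _ _ Zv Wz Szk) -(sU _ _ Zv' Wz' Szt).
have pairN (x y : 'rV[R]_n) : `|((pb, x) : _ * _) - (pb, y)| = `|x - y|.
  by rewrite prod_normE /= subrr normr0 max_r.
have ztE : zt k - zk k = t k *: zk' k by rewrite /zt addrC addKr.
rewrite pairN ztE normrZ gtr0_norm // opprD addrACA.
rewrite (_ : wt k - wk k = t k *: wk' k); last by rewrite /wt addrC addKr.
have := hS _ _ zdel ztdel; rewrite pairN ztE normrZ gtr0_norm //.
rewrite (_ : (pb, zt k) - (pb, zk k) = t k *: (0, zk' k)); last first.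
  by apply: injective_projections => /=; rewrite ?subrr ?scaler0.
rewrite -/D linearZ /=.
set dh := h _ - h _ => dhP lipk.
have : `|dh + t k *: wk' k| <= t k * ((M * 2)^-1 * `|zk' k| + K * tau + tau).
  rewrite (_ : dh + _ = (dh - t k *: D (0, zk' k))
     + t k *: (D (0, zk' k - x') + (wk' k - y'))); last first.
    rewrite (_ : (0, zk' k - x') = (0, zk' k) - (0, x')); last first.
      by apply: injective_projections => /=; rewrite ?subrr.
    rewrite linearB /= addrACA -opprD Dxy subr0 scalerDr addrA subrK //.
  rewrite (le_trans (ler_normD _ _)) // normrZ gtr0_norm //.
  rewrite -[X in _ <= t k * X]addrA mulrDr.
  rewrite lerD //; first by rewrite (le_trans dhP) // mulrCA.
  rewrite ler_pM2l // (le_trans (ler_normD _ _)) // lerD ?(ltW w'tau) //.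
  rewrite (le_trans (DK _)) // ler_pM2l // prod_normE /= normr0 max_r //; exact: ltW.
move=> /(ler_wpM2l (ltW M0)) /(le_trans lipk); rewrite mulrCA ler_pM2l //.
rewrite !mulrDr (_ : M * (_ * `|zk' k|) = `|zk' k| / 2); last first.
  by rewrite -mulrDr invfM !mulrA divff ?gt_eqF // mul1r mulrC.
move=> zk'_le.
have : `|x'| <= `|zk' k| + tau.
  rewrite -[x' in leLHS](subrK (zk' k)) addrC (le_trans (ler_normD _ _)) // lerD2l.
  by rewrite distrC ltW.
have : `|x'| = tau * 2 * (M * K * 2 + M * 2 + 1).
  by rewrite /tau divfK ?pnatr_eq0 // divfK // gt_eqF.
move: x'0 zk'_le; clear.
set a := `|zk' k|; set b := `|x'|; clearbody tau a b => b0 *.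
lra.
Unshelve. all: by end_near.
Qed.

End Generalized.

Lemma cvg_of_inv_bound (R : realType) (V : normedModType R) (f : nat -> V) (l : V)
    (C : R) : 0 < C -> (forall k, `|f k - l| < C * k.+1%:R^-1) -> f @ \oo --> l.
Proof.
move=> C0 fl; apply/cvgrPdist_lt => e e0.
have [N NP] := small_inv (divr_gt0 e0 C0).
exists N => // k Nk; rewrite /= distrC (lt_trans (fl k)) //.
by rewrite mulrC -ltr_pdivlMr //; exact: NP.
Qed.

(** * From the kernel condition to a Lipschitz estimate *)

Section Regularity.
Variables (R : realType) (d n : nat).
Variables (H : 'rV[R]_n -> set 'rV[R]_n) (h : 'rV[R]_d * 'rV[R]_n -> 'rV[R]_n).
Variables (pb : 'rV[R]_d) (xb yb : 'rV[R]_n).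
Hypothesis h_C1 : is_C1 h.
Let D := 'd h (pb, xb).
Hypothesis kernel : forall x' y' : 'rV[R]_n,
  strict_graphical_derivative H xb yb x' y' -> D (0, x') + y' = 0 -> x' = 0.

(** Otherwise normalized secants [u k] of the graph of [H] cluster at some [u0] of norm 1. The
    changes of [p] and of the value are negligible against [t k], so the quotients of [y] tend to
    [- D (0, u0)] and the kernel condition gives [u0 = 0]. *)
Lemma regularity_bound :
  exists K del : R, [/\ 0 < K, 0 < del &
    forall (p q : 'rV[R]_d) (x y x1 y1 : 'rV[R]_n),
      `|p - pb| < del -> `|q - pb| < del -> `|x - xb| < del -> `|x1 - xb| < del ->
      `|y - yb| < del -> `|y1 - yb| < del -> H x y -> H x1 y1 ->
      `|x1 - x| <= K * (`|q - p| + `|(h (q, x1) + y1) - (h (p, x) + y)|)].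
Proof.
apply: contrapT => noK.
have bad k : exists T : ('rV[R]_d * 'rV[R]_d) * ('rV[R]_n * 'rV[R]_n) *
    ('rV[R]_n * 'rV[R]_n),
    let: ((p, q), (x, x1), (y, y1)) := T in
    [/\ `|p - pb| < k.+1%:R^-1 /\ `|q - pb| < k.+1%:R^-1,
        `|x - xb| < k.+1%:R^-1 /\ `|x1 - xb| < k.+1%:R^-1,
        `|y - yb| < k.+1%:R^-1 /\ `|y1 - yb| < k.+1%:R^-1, H x y /\ H x1 y1 &
        k.+1%:R * (`|q - p| + `|(h (q, x1) + y1) - (h (p, x) + y)|) < `|x1 - x|].
  apply: contrapT => Nb; apply: noK; exists k.+1%:R, k.+1%:R^-1; split=> //.
  move=> p q x y x1 y1 *; rewrite leNgt; apply/negP => lt; apply: Nb.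
  by exists ((p, q), (x, x1), (y, y1)).
have [T TP] := choice bad.
pose p k := (T k).1.1.1; pose q k := (T k).1.1.2.
pose x k := (T k).1.2.1; pose x1 k := (T k).1.2.2.
pose y k := (T k).2.1; pose y1 k := (T k).2.2.
have {}TP k : [/\ `|p k - pb| < k.+1%:R^-1 /\ `|q k - pb| < k.+1%:R^-1,
        `|x k - xb| < k.+1%:R^-1 /\ `|x1 k - xb| < k.+1%:R^-1,
        `|y k - yb| < k.+1%:R^-1 /\ `|y1 k - yb| < k.+1%:R^-1,
        H (x k) (y k) /\ H (x1 k) (y1 k) &
        k.+1%:R * (`|q k - p k| + `|(h (q k, x1 k) + y1 k) - (h (p k, x k) + y k)|)
          < `|x1 k - x k|].
  by move: (TP k); rewrite /p /q /x /x1 /y /y1; case: (T k) => [[[? ?] [? ?]] [? ?]].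
clearbody p q x x1 y y1; clear T bad noK.
pose t k := `|x1 k - x k|.
have t0 k : 0 < t k.
  by have [_ _ _ _] := TP k; apply: le_lt_trans; rewrite mulr_ge0 ?addr_ge0.
have dp k : `|q k - p k| <= t k * k.+1%:R^-1.
  have [_ _ _ _ /ltW lt] := TP k; rewrite ler_pdivlMr // mulrC (le_trans _ lt) //.
  by rewrite ler_pM2l // lerDl.
have dv k : `|(h (q k, x1 k) + y1 k) - (h (p k, x k) + y k)| <= t k * k.+1%:R^-1.
  have [_ _ _ _ /ltW lt] := TP k; rewrite ler_pdivlMr // mulrC (le_trans _ lt) //.
  by rewrite ler_pM2l // lerDr.
pose u k := (t k)^-1 *: (x1 k - x k).
have u1 k : `|u k| = 1.
  by rewrite normrZ gtr0_norm ?invr_gt0 // mulVf // gt_eqF.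
have tu k : t k *: u k = x1 k - x k by rewrite scalerA divff ?scale1r // gt_eqF.
have [k|u0 _ u0P] := compact_seq_cluster (@compact_cball R n 0 1) (u := u).
  by rewrite /= subr0 u1.
have sub m : exists k, (m <= k)%N /\ `|u k - u0| < m.+1%:R^-1.
  have m0 : 0 < m.+1%:R^-1 :> R by rewrite invr_gt0.
  by have [k mk uk] := u0P _ m m0; exists k.
have [sg sgP] := choice sub.
have inv_le m : (sg m).+1%:R^-1 <= m.+1%:R^-1 :> R.
  by have [mk _] := sgP m; rewrite lef_pV2 ?posrE // ler_nat ltnS.
suff u00 : u0 = 0.
  by have [k _] := u0P 1 0%N ltr01; rewrite u00 subr0 u1 ltxx.
apply: (kernel (y' := - D (0, u0))); last exact: subrr.
exists (t \o sg), (x \o sg), (y \o sg), (u \o sg),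
  (fun m => (t (sg m))^-1 *: (y1 (sg m) - y (sg m))).
have cvg_sg (V : normedModType R) (f : nat -> V) (l : V) :
    (forall k, `|f k - l| < k.+1%:R^-1) -> (f \o sg) @ \oo --> l.
  move=> fl; apply: (cvg_of_inv_bound ltr01) => m.
  by rewrite mul1r (lt_le_trans (fl _)).
split.
- split=> [m|]; first exact: t0.
  apply: (@cvg_of_inv_bound _ _ _ _ 2) => // m.
  rewrite subr0 gtr0_norm ?t0 // (lt_le_trans _ (_ : 2 * (sg m).+1%:R^-1 <= _)) //.
    have [_ [xk x1k] _ _ _] := TP (sg m).
    rewrite /= /t -(subrKA xb) (le_lt_trans (ler_normD _ _)) //.
    by rewrite [`|xb - _|]distrC mulr_natl mulr2n ltrD.
  by rewrite ler_pM2l.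
- by move=> m; have [_ _ _ [? _] _] := TP (sg m).
- by split; apply: cvg_sg => k; have [_ [? _] [? _] _ _] := TP k.
- split.
    apply: (cvg_of_inv_bound ltr01) => m; rewrite mul1r; exact: (sgP m).2.
  have [K K0 DK] : exists2 K : R, 0 < K & forall u, `|D u| <= K * `|u|.
    by apply: linear_lipschitz; apply: diff_continuous; case: h_C1.
  apply/cvgrPdist_lt => e e0.
  have e30 : 0 < e / 3 by rewrite divr_gt0.
  have [del del0 hS] := C1_strictly_differentiable (pb, xb) h_C1 e30.
  have K10 : 0 < K + 1 by rewrite addr_gt0.
  have min0 : 0 < Num.min del (Num.min 1 (e / 3 / (K + 1))).
    by rewrite !lt_min del0 ltr01 divr_gt0.
  have [N NP] := small_inv min0.
  exists N => // m Nm /=; set k := sg m.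
  have := NP m Nm; rewrite !lt_min => /and3P[mdel m1 me].
  have km := inv_le m; rewrite -/k in km.
  have [[pk qk] [xk x1k] _ _ _] := TP k.
  have near_b (p' : 'rV[R]_d) (x' : 'rV[R]_n) : `|p' - pb| < k.+1%:R^-1 ->
      `|x' - xb| < k.+1%:R^-1 -> `|(p', x') - (pb, xb)| < del.
    move=> p'k x'k; rewrite prod_normE /= gt_max.
    by rewrite !(lt_trans _ mdel) // (lt_le_trans _ km).
  have strict := hS _ _ (near_b _ _ pk xk) (near_b _ _ qk x1k).
  have t1 : t k * k.+1%:R^-1 <= t k.
    by rewrite ger_pMr ?t0 // (le_trans km) // ltW.
  have pairE : (q k, x1 k) - (p k, x k) = t k *: ((t k)^-1 *: (q k - p k), u k).
    apply: injective_projections => /=; last by rewrite tu.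
    by rewrite scalerA divff ?scale1r // gt_eqF.
  have pairN : `|(q k, x1 k) - (p k, x k)| <= t k.
    by rewrite prod_normE /= ge_max lexx andbT (le_trans (dp k)).
  set y' := _ *: _.
  (* Three errors, each at most [e / 3]: the change of the value, the strict differentiability of
     [h], and [D] at the parameter quotient and [u k - u0]. *)
  have -> : - D (0, u0) - y' =
     - ((t k)^-1 *: ((h (q k, x1 k) + y1 k) - (h (p k, x k) + y k)))
     + ((t k)^-1 *: (h (q k, x1 k) - h (p k, x k) - D ((q k, x1 k) - (p k, x k)))
     + D ((t k)^-1 *: (q k - p k), u k - u0)).
    have -> : D ((t k)^-1 *: (q k - p k), u k - u0) =
        (t k)^-1 *: D ((q k, x1 k) - (p k, x k)) - D (0, u0).
      rewrite pairE [in RHS]linearZ /= scalerA mulVf ?gt_eqF // scale1r -linearB.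
      by congr (D _); apply: injective_projections => /=; rewrite ?subr0.
    rewrite /y'; set Dh := D (_ - _); set D0 := D (0, _).
    by apply/rowP => i; rewrite !mxE; ring.
  rewrite (_ : e = e / 3 + (e / 3 + e / 3)); last by field.
  rewrite (le_lt_trans (ler_normD _ _)) // ltrD //.
    rewrite normrN normrZ gtr0_norm ?invr_gt0 // mulrC ltr_pdivrMr //.
    rewrite (le_lt_trans (dv k)) // mulrC ltr_pM2r // (le_lt_trans km) //.
    by rewrite (lt_le_trans me) // ler_pdivrMr // ler_peMr ?lerDr // ltW.
  rewrite (le_lt_trans (ler_normD _ _)) // ler_ltD //.
    rewrite normrZ gtr0_norm ?invr_gt0 // mulrC ler_pdivrMr // (le_trans strict) //.
    by rewrite ler_pM2l.
  rewrite (le_lt_trans (DK _)) //.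
  rewrite (@le_lt_trans _ _ (K * m.+1%:R^-1)) //.
    rewrite ler_pM2l // prod_normE /= ge_max (ltW (sgP m).2) andbT.
    rewrite normrZ gtr0_norm ?invr_gt0 // mulrC ler_pdivrMr //.
    by rewrite (le_trans (dp k)) // mulrC ler_pM2r.
  rewrite mulrC -ltr_pdivlMr // (lt_le_trans me) //.
  by rewrite ler_pM2l // lef_pV2 ?posrE // lerDl.
- move=> m; have [_ _ _ [_ ?] _] := TP (sg m); rewrite /= tu scalerA divff ?gt_eqF //.
  by rewrite scale1r !subrKC.
Qed.

End Regularity.

Lemma C1_locally_lipschitz (R : realType) (U : normedModType R) n
    (f : U -> 'rV[R]_n) (z : U) :
  is_C1 f -> exists M d : R, [/\ 0 < M, 0 < d &
    forall a b, `|a - z| < d -> `|b - z| < d -> `|f b - f a| <= M * `|b - a|].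
Proof.
move=> f_C1; have [d d0 dP] := C1_strictly_differentiable z f_C1 ltr01.
have [K K0 DK] : exists2 K : R, 0 < K & forall u, `|'d f z u| <= K * `|u|.
  by apply: linear_lipschitz; apply: diff_continuous; case: f_C1.
exists (1 + K), d; split=> //; first by rewrite addr_gt0.
move=> a b az bz; rewrite -[f b - f a](subrK ('d f z (b - a))).
by rewrite (le_trans (ler_normD _ _)) // mulrDl lerD // dP.
Qed.

(** * Existence of solutions and of the localization *)

Section Existence.
Variables (R : realType) (d n : nat).
Variables (H : 'rV[R]_n -> set 'rV[R]_n) (h : 'rV[R]_d * 'rV[R]_n -> 'rV[R]_n).
Variables (pb : 'rV[R]_d) (vb xb : 'rV[R]_n).
Hypothesis h_C1 : is_C1 h.
Hypothesis xb_sol : solution_mapping h H (pb, vb) xb.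
Let yb := vb - h (pb, xb).
Hypothesis H_crypto : crypto_continuous H xb yb.
Hypothesis kernel : forall x' y' : 'rV[R]_n,
  strict_graphical_derivative H xb yb x' y' ->
  'd h (pb, xb) (0, x') + y' = 0 -> x' = 0.
Local Notation S := (solution_mapping h H).

(** In the parameter [o] the inclusion becomes the equation [F p o = v], where [F pb] is injective
    and [F p] is uniformly close to it, so [stable_image_nbhs] applies. *)
Lemma solutions_exist (K del eta : R) : 0 < del -> 0 < eta -> eta <= del ->
  (forall (p q : 'rV[R]_d) (x y x1 y1 : 'rV[R]_n),
      `|p - pb| < del -> `|q - pb| < del -> `|x - xb| < del -> `|x1 - xb| < del ->
      `|y - yb| < del -> `|y1 - yb| < del -> H x y -> H x1 y1 ->
      `|x1 - x| <= K * (`|q - p| + `|(h (q, x1) + y1) - (h (p, x) + y)|)) ->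
  exists2 tau : R, 0 < tau & forall p v, `|p - pb| < tau -> `|v - vb| < tau ->
    exists2 x, `|x - xb| < eta & S (p, v) x.
Proof.
move=> del0 eta0 eta_del reg.
have [M [d1 [M0 d10 hM]]] := C1_locally_lipschitz (pb, xb) h_C1.
have [Zc [Wc [Zcn Wcn [A [f [g [om [A_open [f_c g_c] CE om_f _]]]]]]]] := H_crypto.
have Hb : H xb yb.
  by have [y Hy /= hy] := xb_sol; rewrite /yb -hy addrC addKr.
have [ob Aob [fob gob]] : [set (f o, g o) | o in A] (xb, yb).
  by rewrite -CE; split=> //; split; exact: nbhs_singleton.
have H_fg o : A o -> H (f o) (g o).
  move=> Ao; have : [set (f o, g o) | o in A] (f o, g o) by exists o.
  by rewrite -CE => -[].
rewrite continuous_open_subspace // in f_c; rewrite continuous_open_subspace // in g_c.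
have {}f_c o : A o -> {for o, continuous f} by move=> Ao; apply: f_c; rewrite inE.
have {}g_c o : A o -> {for o, continuous g} by move=> Ao; apply: g_c; rewrite inE.
pose e := Num.min eta d1.
have e0 : 0 < e by rewrite lt_min eta0.
have [r1 r10 r1A] : exists2 r : R, 0 < r & forall o, `|o - ob| < r -> A o.
  by apply/nbhs_ball_normP; exact: open_nbhs_nbhs.
have /continuous_normP/(_ _ e0)[r2 r20 r2f] := f_c ob Aob.
have /continuous_normP/(_ _ e0)[r3 r30 r3g] := g_c ob Aob.
rewrite fob in r2f; rewrite gob in r3g.
pose r := Num.min r1 (Num.min r2 r3) / 2.
have r0 : 0 < r by rewrite divr_gt0 // !lt_min r10 r20.
have rP o : `|o - ob| <= r -> [/\ A o, `|f o - xb| < e & `|g o - yb| < e].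
  move=> oar; have : `|o - ob| < Num.min r1 (Num.min r2 r3).
    by apply: (le_lt_trans oar); rewrite ltr_pdivrMr // ltr_pMr ?ltr1n // !lt_min r10 r20.
  rewrite lt_min [X in _ && X]lt_min => /and3P[k1 k2 k3].
  by split; [exact: r1A|exact: r2f|exact: r3g].
pose F p o := h (p, f o) + g o.
have F_c p o : `|o - ob| <= r -> {for o, continuous (F p)}.
  move=> /rP[Ao _ _].
  have hf_c : {for o, continuous (h \o (fun o => (p, f o)))}.
    apply: continuous_comp; first by exact: cvg_section (f_c _ Ao).
    by apply: differentiable_continuous; case: h_C1.
  exact: cvgD hf_c (g_c _ Ao).
have e_le : e <= eta /\ e <= d1 by rewrite !ge_min !lexx orbT.
have pb_del : `|pb - pb| < del by rewrite subrr normr0.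
have F_inj o o' : `|o - ob| <= r -> `|o' - ob| <= r -> F pb o = F pb o' -> o = o'.
  move=> /rP[Ao fo go] /rP[Ao' fo' go'] FE.
  have lt_del t : t < e -> t < del by move=> te; lra.
  (* For equal parameters and values the bound is 0: [f o = f o'], hence [g o = g o'], and [om]
     recovers [o]. *)
  have := reg pb pb _ _ _ _ pb_del pb_del (lt_del _ fo') (lt_del _ fo)
    (lt_del _ go') (lt_del _ go) (H_fg _ Ao') (H_fg _ Ao).
  rewrite -!/(F _ _) FE !subrr !normr0 addr0 mulr0 normr_le0 subr_eq0 => /eqP ff.
  have gg : g o = g o' by move: FE; rewrite /F ff => /addrI.
  by rewrite -(om_f o Ao) -(om_f o' Ao') ff gg.
have [rho rho0 rhoP] := stable_image_nbhs r0 (F_c pb) F_inj.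
(* [rho / M] keeps [F p] within [rho] of [F pb], as [M] is a Lipschitz constant of [h]. *)
exists (Num.min (Num.min d1 rho) (rho / M)); first by rewrite !lt_min d10 rho0 divr_gt0.
move=> p v; rewrite !lt_min => /andP[/andP[pd1 prho] pM] /andP[/andP[_ vrho] _].
have in_d1 q o : `|q - pb| < d1 -> `|o - ob| <= r -> `|(q, f o) - (pb, xb)| < d1.
  move=> qd1 /rP[_ fo _]; rewrite prod_normE /= gt_max qd1 /=; lra.
have pbd1 : `|pb - pb| < d1 by rewrite subrr normr0.
have [w wr Fw] : exists2 o, `|o - ob| <= r & F p o = v.
  apply: rhoP; first exact: F_c.
    move=> o oar; rewrite /F opprD addrACA subrr addr0.
    rewrite (le_trans (hM _ _ (in_d1 _ _ pbd1 oar) (in_d1 _ _ pd1 oar))) //.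
    rewrite prod_normE /= subrr normr0 max_l // mulrC -ler_pdivlMr //; exact: ltW.
  by rewrite /F fob gob subrKC; exact: ltW.
have [Ao fo go] := rP w wr; exists (f w); first lra.
by exists (g w); [exact: H_fg|].
Qed.

Lemma localization_exists : has_lipschitz_localization S (pb, vb) xb.
Proof.
have [K [del [K0 del0 reg]]] := regularity_bound h_C1 kernel.
have [M [d1 [M0 d10 hM]]] := C1_locally_lipschitz (pb, xb) h_C1.
have M10 : 0 < M + 1 by rewrite addr_gt0.
(* If [p], [v] and [x] are within [eta] of their reference points, [y = v - h (p, x)] is within
   [(M + 1) * eta] of [yb], half of [Num.min d1 del], so that [reg] applies. *)
pose eta := Num.min d1 del / ((M + 1) * 2).
have m0 : 0 < Num.min d1 del by rewrite lt_min d10.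
have eta0 : 0 < eta by rewrite divr_gt0 // mulr_gt0.
have etaE : eta * (M + 1) * 2 = Num.min d1 del.
  by rewrite -mulrA divfK // gt_eqF // mulr_gt0.
have eta_min : eta * 2 <= Num.min d1 del.
  by rewrite -etaE ler_pM2r // ler_peMr ?lerDr ?ltW.
have [md md'] : Num.min d1 del <= d1 /\ Num.min d1 del <= del.
  by rewrite !ge_min !lexx orbT.
have eta_del : eta <= del by lra.
have [tau tau0 ex] := solutions_exist del0 eta0 eta_del reg.
pose sg := Num.min tau eta.
have sg0 : 0 < sg by rewrite lt_min tau0.
have sg_eta : sg <= eta by rewrite ge_min lexx orbT.
pose Z := [set u : 'rV[R]_d * 'rV[R]_n | `|u - (pb, vb)| < sg].
pose W := [set x : 'rV[R]_n | `|x - xb| < eta].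
have ZP u : Z u -> `|u.1 - pb| < sg /\ `|u.2 - vb| < sg.
  by rewrite /Z /= prod_normE gt_max => /andP.
have regS u u' x x' : Z u -> Z u' -> W x -> W x' -> S u x -> S u' x' ->
    `|x' - x| <= K * (`|u'.1 - u.1| + `|u'.2 - u.2|).
  move=> /ZP[u1 u2] /ZP[u'1 u'2] Wx Wx' [y Hy hy] [y' Hy' hy'].
  have y_near (w : 'rV[R]_d * 'rV[R]_n) z t : `|w.1 - pb| < sg -> `|w.2 - vb| < sg ->
      `|z - xb| < eta -> h (w.1, z) + t = w.2 -> `|t - yb| < del.
    move=> w1 w2 zx wE.
    have -> : t - yb = (w.2 - vb) - (h (w.1, z) - h (pb, xb)).
      by rewrite -wE /yb; apply/rowP => i; rewrite !mxE; ring.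
    have near_d1 : `|(w.1, z) - (pb, xb)| < d1.
      by rewrite prod_normE /= gt_max; apply/andP; split; lra.
    have near0 : `|(pb, xb) - (pb, xb)| < d1 by rewrite subrr normr0.
    have := hM _ _ near0 near_d1.
    have : M * `|(w.1, z) - (pb, xb)| <= M * eta.
      by rewrite ler_pM2l // prod_normE /= ge_max; apply/andP; split; lra.
    have := ler_normB (w.2 - vb) (h (w.1, z) - h (pb, xb)).
    have : eta * (M + 1) * 2 <= del by rewrite etaE.
    move=> *; lra.
  have {}etad : eta < del by lra.
  have sgd : sg < del by lra.
  rewrite -hy -hy'; apply: reg => //; try exact: (lt_trans _ sgd);
    try exact: (lt_trans _ etad).
  - exact: (y_near u x).
  - exact: (y_near u' x').
have [s sP] : {s : 'rV[R]_d * 'rV[R]_n -> 'rV[R]_n &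
    forall u, Z u -> W (s u) /\ S u (s u)}.
  apply: (@choice _ _ (fun u x => Z u -> W x /\ S u x)) => -[p v].
  have [Zu|] := pselect (Z (p, v)); last by exists xb.
  have [/= p1 v1] := ZP _ Zu.
  have sg_tau : sg <= tau by rewrite ge_min lexx.
  have [x xe Sx] := ex p v (lt_le_trans p1 sg_tau) (lt_le_trans v1 sg_tau).
  by exists x.
have uniq u x x' : Z u -> W x -> W x' -> S u x -> S u x' -> x = x'.
  move=> Zu Wx Wx' Sx Sx'; apply/eqP; rewrite -subr_eq0 -normr_le0.
  by have := regS u u x' x Zu Zu Wx' Wx Sx' Sx; rewrite !subrr !normr0 addr0 mulr0.
have Zb : Z (pb, vb) by rewrite /Z /= subrr normr0.
have Wb : W xb by rewrite /W /= subrr normr0.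
exists Z, W, s; split; last first.
  (* [regS] involves the sum of two norms and the product norm is their maximum, whence the factor
     2. *)
  apply: (@klipschitzW _ _ _ (K * 2)).
    by apply: (@globally_properfilter _ _ ((pb, vb), (pb, vb))).
  move=> [u u'] /= [Zu Zu'].
  have [Wu Su] := sP _ Zu; have [Wu' Su'] := sP _ Zu'.
  rewrite (le_trans (regS _ _ _ _ Zu' Zu Wu' Wu Su' Su)) // -mulrA ler_pM2l //.
  rewrite mulr_natl mulr2n lerD //; first exact: (norm_fst_le (u - u')).
  exact: (norm_snd_le (u - u')).
split.
- by apply/nbhs_ball_normP; exists sg.
- by apply/nbhs_ball_normP; exists eta.
- by have [Ws Ss] := sP _ Zb; apply: (uniq (pb, vb)).
apply/seteqP; split=> [_ [u Zu <-]|[u x] [[/= Zu Wx] Sx]].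
  by have [Ws Ss] := sP _ Zu.
by exists u => //; have [Ws Ss] := sP _ Zu; congr (_, _); exact: (uniq u).
Qed.

End Existence.

Theorem corollary2p6 (R : realType) (d n : nat)
    (H : 'rV[R]_n -> set 'rV[R]_n) (h : 'rV[R]_d * 'rV[R]_n -> 'rV[R]_n)
    (pb : 'rV[R]_d) (vb xb : 'rV[R]_n)
    (H_closed : closed (gph H))
    (h_C1 : is_C1 h)
    (xb_sol : solution_mapping h H (pb, vb) xb)
    (H_crypto : crypto_continuous H xb (vb - h (pb, xb))) :
  has_lipschitz_localization (solution_mapping h H) (pb, vb) xb <->
  (forall x' : 'rV[R]_n,
     (exists2 y' : 'rV[R]_n,
        strict_graphical_derivative H xb (vb - h (pb, xb)) x' y' &
        'd (fun x : 'rV[R]_n => h (pb, x)) xb x' + y' = 0) ->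
     x' = 0).
Proof.
have hd : differentiable h (pb, xb) by case: h_C1.
split=> [loc x' [y' Dy' dxy]|kernel].
  by apply: (localization_kernel h_C1 loc Dy'); rewrite -diff_partial.
apply: localization_exists => // x' y' Dy' dxy.
by apply: kernel; exists y'; rewrite ?diff_partial.
Qed.
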